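(* Let $R$ be a unital ring, let $\mathbf{R}$ be the pre-additive category with one object $*$ and $\mathrm{Hom}_{\mathbf{R}}( *,* )=R$, and let $\mathrm{Mod}^{\mathrm{fg},\mathrm{free}}(R)$ be the additive category of finitely generated free $R$-modules. Then the morphism of pre-additive categories $\mathbf{R}\to\mathrm{Mod}^{\mathrm{fg},\mathrm{free}}(R)$ sending $*$ to $R$ induces an equivalence $$L_{\oplus}(\ell_{\mathbf{preAdd}}(\mathbf{R}))\simeq \ell_{\mathbf{Add}}(\mathrm{Mod}^{\mathrm{fg},\mathrm{free}}(R))$$ in $\mathbf{Add}_\infty$.
   Context: A universe is fixed, ''small'' refers to it, and the ring $R$ belongs to a smaller universe so that its category of (finitely generated) modules is small. Modules are taken on the side for which the endomorphism ring of the module $R$ is $R$ (right modules). $\mathbf{preAdd}$ is the category of small pre-additive ($\mathrm{Ab}$-enriched) categories and enriched functors, $\mathbf{Add}$ its full subcategory of additive categories (those with a zero object and binary sums). Weak equivalences in $\mathbf{preAdd}$ are the enriched functors invertible up to natural isomorphism; $\ell_{\mathbf{preAdd}}\colon\mathbf{preAdd}\to\mathbf{preAdd}_\infty$ is the $\infty$-categorical localization at them. It is equivalent to the coherent nerve of $\mathbf{preAdd}$ enriched by $\mathrm{Map}(\mathbf{A},\mathbf{B})=$ nerve of the groupoid of enriched functors $\mathbf{A}\to\mathbf{B}$ and natural isomorphisms. $\ell_{\mathbf{Add}}\colon\mathbf{Add}\to\mathbf{Add}_\infty$ is the localization of $\mathbf{Add}$ at the weak equivalences; $\mathbf{Add}_\infty$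 is equivalent to the coherent nerve of the full simplicial subcategory $\mathbf{Add}$, and the inclusion induces a fully faithful functor $\mathcal{F}_\oplus\colon\mathbf{Add}_\infty\to\mathbf{preAdd}_\infty$ with left adjoint $L_\oplus$ (additive completion). The equivalence in the claim is the morphism adjoint to $\ell_{\mathbf{preAdd}}(\mathbf{R})\to\ell_{\mathbf{preAdd}}(\mathrm{Mod}^{\mathrm{fg},\mathrm{free}}(R))\simeq\mathcal{F}_\oplus(\ell_{\mathbf{Add}}(\mathrm{Mod}^{\mathrm{fg},\mathrm{free}}(R)))$. *)

(* Defs.v *)
From HB Require Import structures.
From mathcomp Require Import all_boot all_order all_algebra.
From mathcomp Require Import boolp.

Set Implicit Arguments.
Unset Strict Implicit.
Unset Printing Implicit Defensive.

Import GRing.Theory.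

(** * Categories *)

Record category := Category {
  cob :> Type;
  chom : cob -> cob -> Type;
  cid : forall x, chom x x;
  ccomp : forall x y z, chom y z -> chom x y -> chom x z;
  ccomp_idl : forall x y (f : chom x y), ccomp (cid y) f = f;
  ccomp_idr : forall x y (f : chom x y), ccomp f (cid x) = f;
  ccompA : forall x y z t (h : chom z t) (g : chom y z) (f : chom x y),
    ccomp h (ccomp g f) = ccomp (ccomp h g) f
}.
Arguments cid {c} x.
Arguments ccomp {c x y z}.

Record functor (C D : category) := Functor {
  fob :> C -> D;
  fmor : forall x y, chom x y -> chom (fob x) (fob y);
  fmor_id : forall x, fmor (cid x) = cid (fob x);
  fmor_comp : forall x y z (g : chom y z) (f : chom x y),
    fmor (ccomp g f) = ccomp (fmor g) (fmor f)
}.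

Definition functor_comp (C D E : category) (G : functor D E) (F : functor C D) :
  functor C E.
Proof.
refine (@Functor C E (fun x => G (F x)) (fun x y f => fmor G (fmor F f)) _ _).
- by move=> x; rewrite !fmor_id.
- by move=> x y z g f; rewrite !fmor_comp.
Defined.

(** * Simplicial sets

    [ordmap m n] is the set of morphisms from [[m]] to [[n]] in the simplex
    category; the ordinal [[n]] is ['I_n.+1]. *)

Record ordmap (m n : nat) := Ordmap {
  omap :> 'I_m.+1 -> 'I_n.+1;
  omap_homo : forall i j : 'I_m.+1, i <= j -> omap i <= omap j
}.

Lemma ordmap_eq m n (f g : ordmap m n) : f =1 g -> f = g.
Proof.
case: f g => f Hf [g Hg] /= /funext E; subst g.
by rewrite (Prop_irrelevance Hf Hg).
Qed.

Definition ordmap_id n : ordmap n n :=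
  @Ordmap n n (fun i => i) (fun i j h => h).

Definition ordmap_comp k m n (g : ordmap m n) (f : ordmap k m) : ordmap k n :=
  @Ordmap k n (fun i => g (f i))
    (fun i j h => @omap_homo _ _ g _ _ (@omap_homo _ _ f _ _ h)).

Definition ordmap_const m n (i : 'I_n.+1) : ordmap m n :=
  @Ordmap m n (fun=> i) (fun _ _ _ => leqnn i).

Lemma lift_homo n (k : 'I_n.+2) (i j : 'I_n.+1) :
  i <= j -> lift k i <= lift k j.
Proof. by move=> h; rewrite /= leq_bump2. Qed.

Definition coface n (k : 'I_n.+2) : ordmap n n.+1 :=
  @Ordmap n n.+1 (lift k) (@lift_homo n k).

Record sSet := SSet {
  simp :> nat -> Type;
  res : forall m n, ordmap m n -> simp n -> simp m;
  res_id : forall n (x : simp n), res (ordmap_id n) x = x;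
  res_comp : forall k m n (f : ordmap k m) (g : ordmap m n) (x : simp n),
    res (ordmap_comp g f) x = res f (res g x)
}.

Record smap (X Y : sSet) := Smap {
  smap_fun :> forall n, X n -> Y n;
  smap_res : forall m n (f : ordmap m n) (x : X n),
    smap_fun (res f x) = res f (smap_fun x)
}.

Lemma smap_eq (X Y : sSet) (f g : smap X Y) :
  (forall n (x : X n), f n x = g n x) -> f = g.
Proof.
case: f g => f Hf [g Hg] /= E.
have {}E : f = g by apply: functional_extensionality_dep => n; apply: funext.
by subst g; rewrite (Prop_irrelevance Hf Hg).
Qed.

Definition smap_id (X : sSet) : smap X X :=
  @Smap X X (fun _ x => x) (fun _ _ _ _ => erefl).

Definition smap_comp (X Y Z : sSet) (g : smap Y Z) (f : smap X Y) : smap X Z.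
Proof.
refine (@Smap X Z (fun n x => g n (f n x)) _).
by move=> m n a x; rewrite !smap_res.
Defined.

Definition vertex (X : sSet) n (i : 'I_n.+1) (x : X n) : X 0 :=
  res (ordmap_const 0 i) x.
Definition source (X : sSet) (e : X 1) : X 0 := vertex ord0 e.
Definition target (X : sSet) (e : X 1) : X 0 := vertex ord_max e.
Definition degen (X : sSet) (x : X 0) : X 1 := res (ordmap_const 1 ord0) x.

Definition simplex (n : nat) : sSet.
Proof.
refine (@SSet (fun m => ordmap m n) (fun k m f g => ordmap_comp g f) _ _).
- by move=> m f; apply: ordmap_eq.
- by move=> k l m f g h; apply: ordmap_eq.
Defined.

Definition simplex_map m n (f : ordmap m n) : smap (simplex m) (simplex n).
Proof.
refine (@Smap (simplex m) (simplex n) (fun k g => ordmap_comp f g) _).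
by move=> k l a g; apply: ordmap_eq.
Defined.

Definition sprod (X Y : sSet) : sSet.
Proof.
refine (@SSet (fun n => (X n * Y n)%type)
  (fun m n f x => (res f x.1, res f x.2)) _ _).
- by move=> n [x y] /=; rewrite !res_id.
- by move=> k m n f g [x y] /=; rewrite !res_comp.
Defined.

Definition sprod_map (X Y X' Y' : sSet) (f : smap X X') (g : smap Y Y') :
  smap (sprod X Y) (sprod X' Y').
Proof.
refine (@Smap (sprod X Y) (sprod X' Y') (fun n x => (f n x.1, g n x.2)) _).
by move=> m n a [x y] /=; rewrite !smap_res.
Defined.

Definition sfst (X Y : sSet) : smap (sprod X Y) X :=
  @Smap (sprod X Y) X (fun n x => x.1) (fun _ _ _ _ => erefl).

Lemma sig_eq (T : Type) (P : T -> Prop) (x y : {t : T | P t}) :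
  sval x = sval y -> x = y.
Proof.
case: x y => x Px [y Py] /= E; subst y.
by rewrite (Prop_irrelevance Px Py).
Qed.

Lemma vertex_res (X : sSet) m n (f : ordmap m n) (x : X n) i :
  vertex i (res f x) = vertex (f i) x.
Proof.
rewrite /vertex -res_comp; congr res; exact: ordmap_eq.
Qed.

Lemma vertex_smap (X Y : sSet) (f : smap X Y) n (x : X n) i :
  vertex i (f n x) = f 0 (vertex i x).
Proof. by rewrite /vertex smap_res. Qed.

Lemma res_vertices (X : sSet) (P : X 0 -> Prop) m n (f : ordmap m n) (x : X n) :
  (forall i, P (vertex i x)) -> forall i, P (vertex i (res f x)).
Proof. by move=> H i; rewrite vertex_res. Qed.

Lemma smap_vertices (X Y : sSet) (P : Y 0 -> Prop) (f : smap X Y) :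
  (forall x : X 0, P (f 0 x)) ->
  forall n (x : X n) i, P (vertex i (f n x)).
Proof. by move=> H n x i; rewrite vertex_smap. Qed.

(** The full simplicial subset spanned by the vertices satisfying [P]. *)
Definition fullsub (X : sSet) (P : X 0 -> Prop) : sSet.
Proof.
refine (@SSet (fun n => {x : X n | forall i, P (vertex i x)})
  (fun m n f x => exist _ (res f (sval x)) (res_vertices f (svalP x))) _ _).
- by move=> n x; apply: sig_eq; rewrite /= res_id.
- by move=> k m n f g x; apply: sig_eq; rewrite /= res_comp.
Defined.

Definition corestrict (X Y : sSet) (P : Y 0 -> Prop) (f : smap X Y)
  (Hf : forall x : X 0, P (f 0 x)) : smap X (fullsub P).
Proof.
refine (@Smap X (fullsub P) (fun n x => exist _ (f n x) (smap_vertices Hf x)) _).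
by move=> m n a x; apply: sig_eq; rewrite /= smap_res.
Defined.

Definition in_horn n (k : 'I_n.+1) m (g : ordmap m n) : Prop :=
  exists2 i : 'I_n.+1, i != k & forall j, g j != i.

Lemma in_horn_comp n (k : 'I_n.+1) l m (f : ordmap l m) (g : ordmap m n) :
  in_horn k g -> in_horn k (ordmap_comp g f).
Proof. by case=> i ik gi; exists i => // j; apply: gi. Qed.

Definition horn n (k : 'I_n.+1) : sSet.
Proof.
refine (@SSet (fun m => {g : ordmap m n | in_horn k g})
  (fun l m f x => exist _ (ordmap_comp (sval x) f) (in_horn_comp f (svalP x))) _ _).
- by move=> m g; apply: sig_eq; apply: ordmap_eq.
- by move=> a b c f g x; apply: sig_eq; apply: ordmap_eq.
Defined.

Definition horn_incl n (k : 'I_n.+1) : smap (horn k) (simplex n) :=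
  @Smap (horn k) (simplex n) (fun m x => sval x) (fun _ _ _ _ => erefl).

Definition quasicat (X : sSet) : Prop :=
  forall n (k : 'I_n.+1) (h : smap (horn k) X), 0 < k < n ->
    exists s : smap (simplex n) X, smap_comp s (horn_incl k) = h.

(** * The nerve of a category

    An [n]-simplex is a functor from the poset [[n]]. *)

Definition ordcat (n : nat) : category :=
  @Category 'I_n.+1 (fun i j => (i <= j)%N) (fun i => leqnn i)
    (fun i j k jk ij => leq_trans ij jk)
    (fun _ _ _ => bool_irrelevance _ _) (fun _ _ _ => bool_irrelevance _ _)
    (fun _ _ _ _ _ _ _ => bool_irrelevance _ _).

Definition ordfunctor m n (f : ordmap m n) : functor (ordcat m) (ordcat n) :=
  @Functor (ordcat m) (ordcat n) f (@omap_homo m n f)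
    (fun _ => bool_irrelevance _ _) (fun _ _ _ _ _ => bool_irrelevance _ _).

Definition nerve (C : category) : sSet.
Proof.
refine (@SSet (fun n => functor (ordcat n) C)
  (fun m n f x => functor_comp x (ordfunctor f)) _ _).
- move=> n [F F1 F2 F3]; rewrite /functor_comp /=.
  by congr Functor; apply: Prop_irrelevance.
- move=> k m n f g [F F1 F2 F3]; rewrite /functor_comp /=.
  by congr Functor; apply: Prop_irrelevance.
Defined.

Definition nerve_map (C D : category) (F : functor C D) : smap (nerve C) (nerve D).
Proof.
refine (@Smap (nerve C) (nerve D) (fun n x => functor_comp F x) _).
move=> m n a x; rewrite /= /functor_comp /=.
by congr Functor; apply: Prop_irrelevance.
Defined.

Definition nerve_vertex (C : category) (x : C) : nerve C 0.
Proof.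
refine (@Functor (ordcat 0) C (fun=> x) (fun _ _ _ => cid x) _ _).
- by [].
- by move=> *; rewrite ccomp_idl.
Defined.

Section NerveEdge.
Variables (C : category) (x y : C) (f : chom x y).

Definition arrow_ob (i : nat) : C := if i is 0 then x else y.

Definition arrow_hom (i j : nat) : i <= j -> chom (arrow_ob i) (arrow_ob j) :=
  match i, j return i <= j -> chom (arrow_ob i) (arrow_ob j) with
  | 0, 0 => fun=> cid x
  | 0, _.+1 => fun=> f
  | _.+1, 0 => fun h => False_rect _ (notF h)
  | _.+1, _.+1 => fun=> cid y
  end.

Definition nerve_edge : nerve C 1.
Proof.
refine (@Functor (ordcat 1) C (fun i => arrow_ob i)
  (fun i j h => @arrow_hom i j h) _ _).
- by case=> [[|i] Hi].
- case=> [[|i] Hi] [[|j] Hj] [[|k] Hk] //= h h'; rewrite /= ?ccomp_idl ?ccomp_idr //.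
Defined.
End NerveEdge.

Definition edge_mor (C : category) (e : nerve C 1) : chom (fob e ord0) (fob e ord_max) :=
  @fmor _ _ e ord0 ord_max (leq0n _).

(** * Functor quasi-categories, equivalences, localizations, adjunctions *)

Definition Fun (X Y : sSet) : sSet.
Proof.
refine (@SSet (fun n => smap (sprod X (simplex n)) Y)
  (fun m n f G => smap_comp G (sprod_map (smap_id X) (simplex_map f))) _ _).
- move=> n G; apply: smap_eq => k [x a] /=; congr (G k (_, _)).
  exact: ordmap_eq.
- move=> k m n f g G; by apply: smap_eq => l [x a].
Defined.

Definition fun_vertex (X Y : sSet) (F : smap X Y) : Fun X Y 0 :=
  smap_comp F (sfst X (simplex 0)).

Definition postcomp (X Y Z : sSet) (K : smap Y Z) : smap (Fun X Y) (Fun X Z).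
Proof.
refine (@Smap (Fun X Y) (Fun X Z) (fun n G => smap_comp K G) _).
by move=> m n f G; apply: smap_eq.
Defined.

Definition precomp (X Y Z : sSet) (K : smap X Y) : smap (Fun Y Z) (Fun X Z).
Proof.
refine (@Smap (Fun Y Z) (Fun X Z)
  (fun n G => smap_comp G (sprod_map K (smap_id (simplex n)))) _).
by move=> m n f G; apply: smap_eq.
Defined.

Arguments postcomp {X Y Z} K.
Arguments precomp {X Y Z} K.

(** The component at the vertex [x] of an edge of [Fun X Y]. *)
Definition component (X Y : sSet) (h : Fun X Y 1) (x : X 0) : Y 1 :=
  h 1 (degen x, ordmap_id 1).

Definition is_edge (X : sSet) (e : X 1) (x y : X 0) : Prop :=
  source e = x /\ target e = y.

(** [is_composite f g h]: a 2-simplex exhibits [h] as a composite of [f]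
    followed by [g]. *)
Definition is_composite (X : sSet) (f g h : X 1) : Prop :=
  exists s : X 2, [/\ res (coface (inord 2)) s = f,
                      res (coface (inord 0)) s = g
                    & res (coface (inord 1)) s = h].

Definition is_equiv (X : sSet) (f : X 1) : Prop :=
  exists g : X 1, is_composite f g (degen (source f)) /\
                  is_composite g f (degen (target f)).

Definition is_nat_transf (X Y : sSet) (h : Fun X Y 1) (F G : smap X Y) : Prop :=
  is_edge h (fun_vertex F) (fun_vertex G).

Definition is_nat_equiv (X Y : sSet) (h : Fun X Y 1) (F G : smap X Y) : Prop :=
  is_nat_transf h F G /\ is_equiv h.

Definition is_cat_equiv (X Y : sSet) (F : smap X Y) : Prop :=
  exists G : smap Y X,
    (exists h, is_nat_equiv h (smap_id X) (smap_comp G F)) /\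
    (exists h, is_nat_equiv h (smap_comp F G) (smap_id Y)).

Definition inverts (X E : sSet) (W : X 1 -> Prop) (G : Fun X E 0) : Prop :=
  forall e : X 1, W e -> is_equiv (G 1 (e, ordmap_const 1 ord0)).

(** For every quasi-category [E], restriction along [l] is an equivalence from
    [Fun D E] to the full subcategory of [Fun X E] on the functors inverting
    [W]. *)
Definition is_localization (X D : sSet) (W : X 1 -> Prop) (l : smap X D) : Prop :=
  quasicat D /\
  forall E : sSet, quasicat E ->
    exists H : forall G : Fun D E 0, inverts W (precomp l 0 G),
      is_cat_equiv (corestrict H).

(** [L] is left adjoint to [F] with unit [eta] and counit [eps]; the triangle
    identities hold up to homotopy, as 2-simplices of the functor categories. *)
Definition is_adjunction (C D : sSet) (L : smap C D) (F : smap D C)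
    (eta : Fun C C 1) (eps : Fun D D 1) : Prop :=
  [/\ is_nat_transf eta (smap_id C) (smap_comp F L),
      is_nat_transf eps (smap_comp L F) (smap_id D),
      is_composite (postcomp L 1 eta) (precomp L 1 eps)
                   (degen (fun_vertex L))
    & is_composite (precomp F 1 eta) (postcomp F 1 eps)
                   (degen (fun_vertex F))].

(** [g : L c -> d] corresponds to [f : c -> F d] under the adjunction with
    unit [eta]. *)
Definition is_adjoint_morphism (C D : sSet) (L : smap C D) (F : smap D C)
    (eta : Fun C C 1) (c : C 0) (d : D 0) (f : C 1) (g : D 1) : Prop :=
  [/\ is_edge f c (F 0 d), is_edge g (L 0 c) d
    & is_composite (component eta c) (F 1 g) f].

(** * Pre-additive and additive categories *)

Local Open Scope ring_scope.

Record preadd := PreAdd {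
  paob :> Type;
  pahom : paob -> paob -> zmodType;
  paid : forall a, pahom a a;
  pacomp : forall a b c, pahom b c -> pahom a b -> pahom a c;
  pacomp_idl : forall a b (f : pahom a b), pacomp (paid b) f = f;
  pacomp_idr : forall a b (f : pahom a b), pacomp f (paid a) = f;
  pacompA : forall a b c d (h : pahom c d) (g : pahom b c) (f : pahom a b),
    pacomp h (pacomp g f) = pacomp (pacomp h g) f;
  pacompDl : forall a b c (g g' : pahom b c) (f : pahom a b),
    pacomp (g + g') f = pacomp g f + pacomp g' f;
  pacompDr : forall a b c (g : pahom b c) (f f' : pahom a b),
    pacomp g (f + f') = pacomp g f + pacomp g f'
}.
Arguments paid {p} a.
Arguments pacomp {p a b c}.

Record pfunctor (A B : preadd) := PFunctor {
  pfob :> A -> B;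
  pfmor : forall a b, pahom a b -> pahom (pfob a) (pfob b);
  pfmorD : forall a b (f g : pahom a b), pfmor (f + g) = pfmor f + pfmor g;
  pfmor_id : forall a, pfmor (paid a) = paid (pfob a);
  pfmor_comp : forall a b c (g : pahom b c) (f : pahom a b),
    pfmor (pacomp g f) = pacomp (pfmor g) (pfmor f)
}.

Definition pfunctor_id (A : preadd) : pfunctor A A :=
  @PFunctor A A (fun a => a) (fun _ _ f => f)
    (fun _ _ _ _ => erefl) (fun _ => erefl) (fun _ _ _ _ _ => erefl).

Definition pfunctor_comp (A B C : preadd) (G : pfunctor B C) (F : pfunctor A B) :
  pfunctor A C.
Proof.
refine (@PFunctor A C (fun a => G (F a)) (fun a b f => pfmor G (pfmor F f)) _ _ _).
- by move=> a b f g; rewrite !pfmorD.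
- by move=> a; rewrite !pfmor_id.
- by move=> a b c g f; rewrite !pfmor_comp.
Defined.

Definition preAdd : category.
Proof.
refine (@Category preadd pfunctor pfunctor_id pfunctor_comp _ _ _).
- move=> A B [F F1 F2 F3 F4]; rewrite /pfunctor_comp /=.
  by congr PFunctor; apply: Prop_irrelevance.
- move=> A B [F F1 F2 F3 F4]; rewrite /pfunctor_comp /=.
  by congr PFunctor; apply: Prop_irrelevance.
- move=> A B C D H G F; rewrite /pfunctor_comp /=.
  by congr PFunctor; apply: Prop_irrelevance.
Defined.

(** Natural transformations between enriched functors are the ordinary ones:
    enrichment in abelian groups imposes no further condition. *)
Definition is_iso (A : preadd) (a b : A) (f : pahom a b) : Prop :=
  exists g : pahom b a, pacomp g f = paid a /\ pacomp f g = paid b.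

Definition nat_isomorphic (A B : preadd) (F G : pfunctor A B) : Prop :=
  exists t : forall a, pahom (F a) (G a),
    (forall a b (f : pahom a b), pacomp (t b) (pfmor F f) = pacomp (pfmor G f) (t a))
    /\ (forall a, is_iso (t a)).

Definition weak_equiv (A B : preadd) (F : pfunctor A B) : Prop :=
  exists G : pfunctor B A,
    nat_isomorphic (pfunctor_comp G F) (pfunctor_id A) /\
    nat_isomorphic (pfunctor_comp F G) (pfunctor_id B).

Definition is_zero_object (A : preadd) (z : A) : Prop :=
  forall a : A, (exists! f : pahom z a, True) /\ (exists! f : pahom a z, True).

Definition is_sum (A : preadd) (a b s : A) (i : pahom a s) (j : pahom b s) : Prop :=
  forall (c : A) (f : pahom a c) (g : pahom b c),
    exists! h : pahom s c, pacomp h i = f /\ pacomp h j = g.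

Definition additive_cat (A : preadd) : Prop :=
  (exists z : A, is_zero_object z) /\
  (forall a b : A, exists (s : A) (i : pahom a s) (j : pahom b s), is_sum i j).

Definition Add : category :=
  @Category {A : preadd | additive_cat A} (fun A B => pfunctor (sval A) (sval B))
    (fun A => pfunctor_id (sval A))
    (fun A B C => @pfunctor_comp (sval A) (sval B) (sval C))
    (fun A B => @ccomp_idl preAdd (sval A) (sval B))
    (fun A B => @ccomp_idr preAdd (sval A) (sval B))
    (fun A B C D => @ccompA preAdd (sval A) (sval B) (sval C) (sval D)).

Definition Add_incl : functor Add preAdd :=
  @Functor Add preAdd (fun A => sval A) (fun _ _ F => F)
    (fun _ => erefl) (fun _ _ _ _ _ => erefl).

Definition weq_preAdd (e : nerve preAdd 1) : Prop := weak_equiv (edge_mor e).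
Definition weq_Add (e : nerve Add 1) : Prop := weak_equiv (edge_mor e).

(** * The category of finitely generated free modules

    Right [R]-modules are left modules over the converse ring [R^c]. *)

Definition one_object (R : pzRingType) : preadd :=
  @PreAdd unit (fun _ _ => R) (fun _ => 1) (fun _ _ _ r s => r * s)
    (fun _ _ => @mul1r R) (fun _ _ => @mulr1 R) (fun _ _ _ _ => @mulrA R)
    (fun _ _ _ r r' s => @mulrDl R r r' s) (fun _ _ _ => @mulrDr R).

Section Modules.
Variable R : pzRingType.
Implicit Types M N P : lmodType R^c.

(** [zmodType] demands a choice structure, which for linear maps is supplied
    classically; pre-additive functors do not see it. *)
Definition linhom M N : Type := {linear M -> N}.

Lemma linhom_eq M N (f g : {linear M -> N}) : f =1 g -> f = g.
Proof.
case: f g => [f [[a] [b]]] [g [[c] [d]]] /= /funext E; subst g.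
by rewrite (Prop_irrelevance a c) (Prop_irrelevance b d).
Qed.

HB.instance Definition _ M N := gen_eqMixin (linhom M N).
HB.instance Definition _ M N := gen_choiceMixin (linhom M N).

Section LinhomZmodule.
Variables M N : lmodType R^c.

Definition linhom0 : linhom M N := (\0%R : {linear M -> N}).
Definition linhomN (f : {linear M -> N}) : linhom M N :=
  (\- f : {linear M -> N}).
Definition linhomD (f g : {linear M -> N}) : linhom M N :=
  (f \+ g : {linear M -> N}).

Lemma linhomA : associative linhomD.
Proof. by move=> f g h; apply: linhom_eq => x /=; rewrite addrA. Qed.
Lemma linhomC : commutative linhomD.
Proof. by move=> f g; apply: linhom_eq => x /=; rewrite addrC. Qed.
Lemma linhom_add0 : left_id linhom0 linhomD.
Proof. by move=> f; apply: linhom_eq => x /=; rewrite add0r. Qed.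
Lemma linhom_addN : left_inverse linhom0 linhomN linhomD.
Proof. by move=> f; apply: linhom_eq => x /=; rewrite addNr. Qed.

HB.instance Definition _ := GRing.isZmodule.Build (linhom M N)
  linhomA linhomC linhom_add0 linhom_addN.
End LinhomZmodule.

Definition linhom_id M : linhom M M := (idfun : {linear M -> M}).
Definition linhom_comp M N P (g : {linear N -> P}) (f : {linear M -> N}) :
  linhom M P := (g \o f : {linear M -> P}).

(** [M] is isomorphic to [R^n] for some [n]. *)
Definition fg_free M : Prop :=
  exists n : nat, exists f : {linear 'rV[R^c]_n -> M}, bijective f.

Definition Mod_fgfree : preadd.
Proof.
refine (@PreAdd {M : lmodType R^c | fg_free M}
  (fun A B => linhom (sval A) (sval B) : zmodType)
  (fun A => linhom_id (sval A))
  (fun A B C => @linhom_comp (sval A) (sval B) (sval C)) _ _ _ _ _).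
- by move=> M N f; apply: linhom_eq.
- by move=> M N f; apply: linhom_eq.
- by move=> M N P Q h g f; apply: linhom_eq.
- by move=> M N P g g' f; apply: linhom_eq.
- by move=> M N P g f f'; apply: linhom_eq => x /=; rewrite linearD.
Defined.

Lemma fg_free0 : fg_free 'rV[R^c]_0.
Proof. by exists 0%N, (idfun : {linear _ -> _}); exists idfun. Qed.

Lemma fg_free_regular : fg_free (R^c)^o.
Proof.
pose f (v : 'rV[R^c]_1) : (R^c)^o := v ord0 ord0.
have lf : linear f by move=> a u v; rewrite /f !mxE.
pose F := HB.pack_for {linear 'rV[R^c]_1 -> (R^c)^o} f (GRing.isLinear.Build _ _ _ _ f lf).
exists 1%N, F; exists (fun x => \row_(_ < 1) x) => [v|x] /=.
- by apply/rowP => i; rewrite mxE /f; congr (v _ _); apply/ord_inj; case: i => [[]].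
- by rewrite /f mxE.
Qed.

Lemma fg_free_pair M N : fg_free M -> fg_free N -> fg_free (M * N)%type.
Proof.
move=> [m [f [f' fK f'K]]] [n [g [g' gK g'K]]].
pose h (v : 'rV[R^c]_(m + n)) : (M * N)%type := (f (lsubmx v), g (rsubmx v)).
have lh : linear h by move=> a u v; rewrite /h !linearP.
pose H := HB.pack_for {linear 'rV[R^c]_(m + n) -> (M * N)%type} h
  (GRing.isLinear.Build _ _ _ _ h lh).
exists (m + n)%N, H; exists (fun x => row_mx (f' x.1) (g' x.2)) => [v|[x y]] /=.
- by rewrite fK gK hsubmxK.
- by rewrite /h row_mxKl row_mxKr f'K g'K.
Qed.

Lemma Mod_fgfree_additive : additive_cat Mod_fgfree.
Proof.
split.
- exists (exist _ _ fg_free0) => M; split.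
  + exists 0; split=> // f _; apply: linhom_eq => x.
    by rewrite (_ : x = 0) ?linear0 //; apply/rowP; case.
  + by exists 0; split=> // f _; apply: linhom_eq => x; apply/rowP; case.
- move=> [M HM] [N HN].
  pose i x : (M * N)%type := (x, 0); pose j y : (M * N)%type := (0, y).
  have li : linear i by move=> a u v; apply/pair_equal_spec; rewrite /= scaler0 addr0.
  have lj : linear j by move=> a u v; apply/pair_equal_spec; rewrite /= scaler0 addr0.
  exists (exist _ _ (fg_free_pair HM HN)).
  exists (HB.pack_for {linear M -> (M * N)%type} i (GRing.isLinear.Build _ _ _ _ i li)).
  exists (HB.pack_for {linear N -> (M * N)%type} j (GRing.isLinear.Build _ _ _ _ j lj)).
  move=> [P HP] /= f g.
  pose h (x : (M * N)%type) : P := (f : {linear M -> P}) x.1 + (g : {linear N -> P}) x.2.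
  have lh : linear h.
    by move=> a u v; rewrite /h /= !linearP scalerDr addrACA.
  exists (HB.pack_for {linear (M * N)%type -> P} h (GRing.isLinear.Build _ _ _ _ h lh)).
  split.
  + by split; apply: linhom_eq => x; rewrite /= /h /= linear0 ?addr0 ?add0r.
  + move=> k [kf kg]; apply: linhom_eq => -[x y] /=; rewrite /h -kf -kg /=.
    by rewrite -linearD; congr (_ _); apply/pair_equal_spec; rewrite /= addr0 add0r.
Qed.

Definition ModAdd : Add := exist _ Mod_fgfree Mod_fgfree_additive.

(** The right module [R], and multiplication by [r] on its left. *)
Definition regular_module : Mod_fgfree := exist _ _ fg_free_regular.

Definition lmul (r : R) (x : (R^c)^o) : (R^c)^o := r * (x : R).

Lemma lmul_is_linear r : linear (lmul r).
Proof. move=> a u v; rewrite /lmul mulrDr; congr (_ + _); exact: (@mulrA R r u a). Qed.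

HB.instance Definition _ r := GRing.isLinear.Build _ _ _ _ (lmul r) (lmul_is_linear r).

Definition one_object_to_Mod : pfunctor (one_object R) Mod_fgfree.
Proof.
refine (@PFunctor (one_object R) Mod_fgfree (fun=> regular_module)
  (fun _ _ r => (lmul r : {linear _ -> _})) _ _ _).
- by move=> ? ? r s; apply: linhom_eq => x; exact: (@mulrDl R).
- by move=> ?; apply: linhom_eq => x; exact: (@mul1r R).
- by move=> ? ? ? r s; apply: linhom_eq => x; exact/esym/(@mulrA R).
Defined.

End Modules.

(* Main.v *)
(** In the homotopy category of a localization of the nerve of [C] at [W], every
    object is isomorphic to one of [C], and the morphisms between two objects of
    [C] are those of [C] modulo any congruence [sim] under which [W] becomes
    invertible and whose relation is witnessed by cylinders; this uses the
    universal property only for maps into nerves of ordinary categories, applied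
    to [C / sim] and to the homotopy category itself. For [preAdd] and [Add],
    [sim] is natural isomorphism. Equivalences are detected in homotopy
    categories, where the adjunction [L -| F] becomes an ordinary one, so that
    the claim reduces to: restriction along [R -> Mod] is a bijection on
    isomorphism classes of pre-additive functors to an additive category. This
    holds because every finitely generated free module is a finite biproduct of
    copies of [R], whose endomorphism ring is [R]. *)

From HB Require Import structures.
Require Import Defs.
From mathcomp Require Import all_boot all_order all_algebra.
From mathcomp Require Import boolp zify.

Set Implicit Arguments.
Unset Strict Implicit.
Unset Printing Implicit Defensive.

(** * Categories with a single type of arrows *)

(** A localization is known only through an equivalence of functor quasi-categories with an abstract
    inverse. Functors therefore extend along [l] only up to equivalence, and uniqueness comes as a
    zigzag of equivalences, so functors to an ordinary category are compared by natural isomorphism,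
    never by equality. Two comparisons control the homotopy category: the quotient functor from [C]
    extends to a functor [P] from the localization to [C / sim], and following [P] by the canonical
    functor [quo_ho] back to the homotopy category is isomorphic to the identity, because both
    restrict to the same functor on [C]. The functor [quo_ho] exists because the two ends of a
    cylinder are sections of one inverted projection and so become equal. Using the universal
    property this way requires nerves to be quasi-categories and maps into nerves to be given by
    their effect on edges, which is why [anerve] is built from edges. At the end the morphism from
    [R] to [F] of the module category is shown to be a universal arrow, as is the unit of the
    adjunction, and universal arrows agree up to isomorphism. *)

(** All arrows form one type, because the endpoints of edges in a simplicial set
    are only propositionally equal to the expected ones. [acmp f g] is [f]
    followed by [g]; it is junk unless [atgt f = asrc g]. *)
Record acat := ACat {
  aob : Type;
  aar : Type;
  asrc : aar -> aob;
  atgt : aar -> aob;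
  aid : aob -> aar;
  acmp : aar -> aar -> aar;
  asrc_id : forall x, asrc (aid x) = x;
  atgt_id : forall x, atgt (aid x) = x;
  asrc_cmp : forall f g, atgt f = asrc g -> asrc (acmp f g) = asrc f;
  atgt_cmp : forall f g, atgt f = asrc g -> atgt (acmp f g) = atgt g;
  acmp_idl : forall f x, asrc f = x -> acmp (aid x) f = f;
  acmp_idr : forall f x, atgt f = x -> acmp f (aid x) = f;
  acmpA : forall f g h, atgt f = asrc g -> atgt g = asrc h ->
    acmp f (acmp g h) = acmp (acmp f g) h
}.

Definition aiso (K : acat) (f g : aar K) : Prop :=
  [/\ asrc g = atgt f, atgt g = asrc f,
      acmp f g = aid (asrc f) & acmp g f = aid (atgt f)].

Lemma aiso_sym (K : acat) (f g : aar K) : aiso f g -> aiso g f.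
Proof. by case=> s t fg gf; split; rewrite ?s ?t. Qed.

Record afun (K K' : acat) := AFun {
  afob : aob K -> aob K';
  afar :> aar K -> aar K';
  asrc_fun : forall f, asrc (afar f) = afob (asrc f);
  atgt_fun : forall f, atgt (afar f) = afob (atgt f);
  afun_id : forall x, afar (aid x) = aid (afob x);
  afun_cmp : forall f g, atgt f = asrc g ->
    afar (acmp f g) = acmp (afar f) (afar g)
}.

Lemma afun_iso (K K' : acat) (F : afun K K') (f g : aar K) :
  aiso f g -> aiso (F f) (F g).
Proof.
case=> s t fg gf; split; rewrite ?asrc_fun ?atgt_fun ?s ?t //.
  by rewrite -afun_cmp // fg afun_id.
by rewrite -afun_cmp // gf afun_id.
Qed.

(** * Homotopy classes of edges form a category *)

Section Quotient.
Variables (T : Type) (E : T -> T -> Prop).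
Hypothesis Erefl : forall x, E x x.
Hypothesis Esym : forall x y, E x y -> E y x.
Hypothesis Etrans : forall x y z, E x y -> E y z -> E x z.

Definition quo : Type := {P : T -> Prop | exists x, P = E x}.

Definition qcls (x : T) : quo := exist _ (E x) (ex_intro _ x erefl).

Lemma qcls_eq x y : E x y -> qcls x = qcls y.
Proof.
move=> xy; apply: sig_eq => /=; apply: funext => z; apply: propext.
by split; apply: Etrans => //; apply: Esym.
Qed.

Lemma qcls_inj x y : qcls x = qcls y -> E x y.
Proof. by case=> ->. Qed.

Definition qrep (c : quo) : T := sval (cid (svalP c)).

Lemma qrepK c : qcls (qrep c) = c.
Proof. by apply: sig_eq; rewrite /= /qrep; case: cid. Qed.

End Quotient.

(** Kept apart from the laws of [pres], because functorial maps out of it are wanted for every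
    simplicial set, including those not known to be quasi-categories. *)
Record egraph := EGraph {
  edge_ob : Type;
  edge : Type;
  esrc : edge -> edge_ob;
  etgt : edge -> edge_ob;
  eid : edge_ob -> edge;
  ecomp : edge -> edge -> edge -> Prop
}.

(** [ecomp f g h] ("[h] is a composite of [f] followed by [g]") is assumed to
    have the closure properties of the 2-simplices of a quasi-category. *)
Record pres := Pres {
  pgraph :> egraph;
  esrc_id : forall x : edge_ob pgraph, esrc (eid x) = x;
  etgt_id : forall x : edge_ob pgraph, etgt (eid x) = x;
  ecomp_ends : forall f g h : edge pgraph, ecomp f g h ->
    [/\ etgt f = esrc g, esrc h = esrc f & etgt h = etgt g];
  ecomp_ex : forall f g : edge pgraph, etgt f = esrc g -> exists h, ecomp f g h;
  ecomp_idl : forall f : edge pgraph, ecomp (eid (esrc f)) f f;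
  ecomp_idr : forall f : edge pgraph, ecomp f (eid (etgt f)) f;
  ecomp_assl : forall a b c ab bc x : edge pgraph,
    ecomp a b ab -> ecomp b c bc -> ecomp a bc x -> ecomp ab c x;
  ecomp_assr : forall a b c ab bc x : edge pgraph,
    ecomp a b ab -> ecomp b c bc -> ecomp ab c x -> ecomp a bc x
}.

Section Presentation.
Variable P : pres.

Definition homotopic (f g : edge P) : Prop := ecomp f (eid (etgt f)) g.

Lemma homotopic_src f g : homotopic f g -> esrc f = esrc g.
Proof. by case/ecomp_ends. Qed.

Lemma homotopic_tgt f g : homotopic f g -> etgt f = etgt g.
Proof. by case/ecomp_ends=> _ _ ->; rewrite etgt_id. Qed.

Lemma homotopic_refl f : homotopic f f.
Proof. exact: ecomp_idr. Qed.

(** Associating [a], [b] and the identity at the target of [b] in two ways turns the second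
    composite into a homotopy from the first. *)
Lemma ecomp_unique a b c c' : ecomp a b c -> ecomp a b c' -> homotopic c c'.
Proof.
move=> H H'; rewrite /homotopic; have [_ _ ->] := ecomp_ends H.
exact: ecomp_assl H (ecomp_idr b) H'.
Qed.

Lemma ecomp_homotopic a b c c' : ecomp a b c -> homotopic c c' -> ecomp a b c'.
Proof.
move=> H; rewrite /homotopic; have [_ _ ->] := ecomp_ends H.
exact: ecomp_assr H (ecomp_idr b).
Qed.

(** Both [f] and [g] are composites of [f] with an identity. *)
Lemma homotopic_sym f g : homotopic f g -> homotopic g f.
Proof. by move=> H; apply: ecomp_unique H (ecomp_idr f). Qed.

Lemma homotopic_trans f g h : homotopic f g -> homotopic g h -> homotopic f h.
Proof. exact: ecomp_homotopic. Qed.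

Lemma ecomp_homotopicr a b b' c : ecomp a b c -> homotopic b b' -> ecomp a b' c.
Proof.
move=> H H'; apply: (ecomp_assr H H').
by have [_ _ <-] := ecomp_ends H; apply: ecomp_idr.
Qed.

Lemma ecomp_homotopicl a a' b c : ecomp a b c -> homotopic a a' -> ecomp a' b c.
Proof.
move=> H H'; apply: (ecomp_assl H' _ H).
by have [-> _ _] := ecomp_ends H; apply: ecomp_idl.
Qed.

Let Q := quo homotopic.
Let cls := qcls homotopic.

Lemma cls_eq f g : homotopic f g -> cls f = cls g.
Proof. exact: qcls_eq homotopic_sym homotopic_trans _ _. Qed.

Lemma cls_inj f g : cls f = cls g -> homotopic f g.
Proof. apply: qcls_inj; exact: homotopic_refl. Qed.

Let rep (c : Q) : edge P := qrep c.

Lemma rep_cls f : homotopic (rep (cls f)) f.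
Proof. by apply: cls_inj; rewrite /cls qrepK. Qed.

Lemma quo_ind (S : Q -> Prop) : (forall f, S (cls f)) -> forall c, S c.
Proof. by move=> H c; rewrite -(qrepK c). Qed.

(** Composability is decided classically; the value [f] for classes that do not compose is junk, on
    which [acat] imposes nothing. *)
Definition pcmp (f g : Q) : Q :=
  if pselect (exists h, ecomp (rep f) (rep g) h) is left H
  then cls (sval (cid H)) else f.

Lemma pcmp_cls f g h : ecomp f g h -> pcmp (cls f) (cls g) = cls h.
Proof.
move=> H.
have H' : ecomp (rep (cls f)) (rep (cls g)) h.
  apply: ecomp_homotopicl (homotopic_sym (rep_cls f)).
  exact: ecomp_homotopicr (homotopic_sym (rep_cls g)).
rewrite /pcmp; case: pselect => [H0|[]]; last by exists h.
case: cid => h' /= Hh'; apply: cls_eq; exact: ecomp_unique Hh' H'.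
Qed.

Lemma src_cls f : esrc (rep (cls f)) = esrc f.
Proof. exact/homotopic_src/rep_cls. Qed.

Lemma tgt_cls f : etgt (rep (cls f)) = etgt f.
Proof. exact/homotopic_tgt/rep_cls. Qed.

Definition presented : acat.
Proof.
refine (@ACat (edge_ob P) Q (fun f => esrc (rep f)) (fun f => etgt (rep f))
  (fun x => cls (eid x)) pcmp _ _ _ _ _ _ _).
- by move=> x; rewrite src_cls esrc_id.
- by move=> x; rewrite tgt_cls etgt_id.
- move=> f g; elim/quo_ind: f => f; elim/quo_ind: g => g.
  rewrite !src_cls tgt_cls => /ecomp_ex[h H].
  by rewrite (pcmp_cls H) src_cls; case: (ecomp_ends H).
- move=> f g; elim/quo_ind: f => f; elim/quo_ind: g => g.
  rewrite !src_cls !tgt_cls => /ecomp_ex[h H].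
  by rewrite (pcmp_cls H) tgt_cls; case: (ecomp_ends H).
- move=> f x; elim/quo_ind: f => f; rewrite src_cls => <-.
  by apply/pcmp_cls/ecomp_idl.
- move=> f x; elim/quo_ind: f => f; rewrite tgt_cls => <-.
  by apply/pcmp_cls/ecomp_idr.
- move=> f g h; elim/quo_ind: f => f; elim/quo_ind: g => g.
  elim/quo_ind: h => h; rewrite !tgt_cls !src_cls => fg gh.
  have [a Ha] := ecomp_ex fg; have [b Hb] := ecomp_ex gh.
  have [|c Hc] := @ecomp_ex P f b; first by case: (ecomp_ends Hb) => _ -> _.
  by rewrite (pcmp_cls Ha) (pcmp_cls Hb) (pcmp_cls Hc) (pcmp_cls (ecomp_assl Ha Hb Hc)).
Defined.

Definition pcls : edge P -> aar presented := cls.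

Lemma pcls_src f : asrc (pcls f) = esrc f. Proof. exact: src_cls. Qed.
Lemma pcls_tgt f : atgt (pcls f) = etgt f. Proof. exact: tgt_cls. Qed.
Lemma pcls_id x : pcls (eid x) = aid (x : aob presented). Proof. by []. Qed.

Lemma pcls_surj (c : aar presented) : exists f, pcls f = c.
Proof. by exists (rep c); apply: qrepK. Qed.

Lemma pcls_eqP f g : pcls f = pcls g <-> homotopic f g.
Proof. by split; [apply: cls_inj | apply: cls_eq]. Qed.

Lemma pcls_cmp f g h : ecomp f g h -> pcls h = acmp (pcls f) (pcls g).
Proof. by move=> H; rewrite /= (pcmp_cls H). Qed.

Lemma pcls_cmpP f g h : etgt f = esrc g -> pcls h = acmp (pcls f) (pcls g) -> ecomp f g h.
Proof.
move=> /ecomp_ex[h' H]; rewrite -(pcls_cmp H) => /pcls_eqP /homotopic_sym.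
exact: ecomp_homotopic.
Qed.

End Presentation.

(** * Nerves are quasi-categories *)

Definition omax n (i j : 'I_n) : 'I_n := if i <= j then j else i.

Lemma omaxE n (i j : 'I_n) : omax i j = maxn i j :> nat.
Proof. by rewrite /omax; case: leqP. Qed.

Definition ordedge_fun n (i j : 'I_n.+1) (a : 'I_2) : 'I_n.+1 :=
  if a == ord0 then i else omax i j.

Lemma ordedge_homo n (i j : 'I_n.+1) (a b : 'I_2) :
  a <= b -> ordedge_fun i j a <= ordedge_fun i j b.
Proof.
rewrite /ordedge_fun; case: eqP => [->|]; case: eqP => [->|] //.
  by rewrite omaxE leq_maxl.
by move=> /eqP; rewrite -val_eqE /=; case: a => [[|a] ?] //=.
Qed.

(** The map [[1] -> [n]] with image [i <= j]; constant when [j <= i]. *)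
Definition ordedge n (i j : 'I_n.+1) : ordmap 1 n := Ordmap (@ordedge_homo n i j).

Lemma ordedge1 n (i j : 'I_n.+1) : i <= j -> ordedge i j ord_max = j.
Proof. by rewrite /= /ordedge_fun /omax /= => ->. Qed.

Lemma ord2P (P : 'I_2 -> Prop) : P ord0 -> P ord_max -> forall i, P i.
Proof.
move=> P0 P1 [[|[|i]] h] //.
  by have -> : Ordinal h = ord0 by apply: ord_inj.
by have -> : Ordinal h = ord_max by apply: ord_inj.
Qed.

Lemma ordmap1_eq n (f g : ordmap 1 n) :
  f ord0 = g ord0 -> f ord_max = g ord_max -> f = g.
Proof. by move=> h0 h1; apply: ordmap_eq => i; elim/ord2P: i. Qed.

Lemma ordedge_comp m n (f : ordmap m n) (i j : 'I_m.+1) :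
  ordmap_comp f (ordedge i j) = ordedge (f i) (f j).
Proof.
apply: ordmap1_eq => //=; rewrite /ordedge_fun /= /omax.
case: (leqP i j) => [ij|/ltnW ji]; first by rewrite omap_homo.
case: leqP => // ij; apply: ord_inj; apply/eqP.
by rewrite eqn_leq ij omap_homo.
Qed.

Lemma ordedge_const n (i j : 'I_n.+1) : j <= i ->
  ordedge i j = ordmap_comp (ordmap_const 0 i) (ordmap_const 1 ord0).
Proof.
move=> ji; apply: ordmap1_eq => //=; rewrite /ordedge_fun /=.
by apply: ord_inj; rewrite omaxE; apply/maxn_idPl.
Qed.

(** The last clause bounds the image, so that the triangle lies in a horn as soon as its three
    vertices avoid a common vertex other than [k]. *)
Lemma ordtri_ex n (p j q : 'I_n.+1) : p <= j -> j <= q ->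
  exists g : ordmap 2 n, [/\ g (inord 0) = p, g (inord 1) = j, g (inord 2) = q
    & forall c, [\/ g c = p, g c = j | g c = q]].
Proof.
move=> pj jq; pose g (c : 'I_3) := if c == inord 0 then p else if c == inord 1 then j else q.
have gh (a b : 'I_3) : a <= b -> g a <= g b.
  rewrite /g -!val_eqE /= !inordK //.
  by case: a b => [[|[|[|a]]] ?] [[|[|[|b]]] ?] //= _; apply: leq_trans pj jq.
exists (Ordmap gh) => /=; split; rewrite /g -?val_eqE /= ?inordK // => c.
by case: ifP; [constructor 1|case: ifP; [constructor 2|constructor 3]].
Qed.

Definition asimplex (K : acat) n (s : 'I_n.+1 -> 'I_n.+1 -> aar K) : Prop :=
  (forall i j : 'I_n.+1, j <= i -> s i j = aid (asrc (s i i))) /\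
  (forall i j k : 'I_n.+1, i <= j -> j <= k ->
     atgt (s i j) = asrc (s j k) /\ s i k = acmp (s i j) (s j k)).

Lemma asimplex_src (K : acat) n (s : 'I_n.+1 -> 'I_n.+1 -> aar K) i j :
  asimplex s -> asrc (s i j) = asrc (s i i).
Proof.
case=> s1 s2; case: (leqP j i) => [/s1 ->|/ltnW ij]; first by rewrite asrc_id.
by have [e ->] := s2 i i j (leqnn _) ij; rewrite asrc_cmp.
Qed.

Lemma asimplex_tgt (K : acat) n (s : 'I_n.+1 -> 'I_n.+1 -> aar K) (i j : 'I_n.+1) :
  asimplex s -> i <= j -> atgt (s i j) = asrc (s j j).
Proof. by case=> s1 s2 ij; have [] := s2 i j j ij (leqnn _). Qed.

Lemma asimplex_res (K : acat) m n (f : ordmap m n)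
  (s : 'I_n.+1 -> 'I_n.+1 -> aar K) :
  asimplex s -> asimplex (fun i j => s (f i) (f j)).
Proof.
case=> s1 s2; split=> [i j ij|i j k ij jk].
  by apply: s1; apply: omap_homo.
by apply: s2; apply: omap_homo.
Qed.

(** The nerve, an [n]-simplex being given by all its edges [s i j], [i <= j];
    below the diagonal the entries are junk, normalized to identities. *)
Definition anerve (K : acat) : sSet.
Proof.
refine (@SSet (fun n => {s : 'I_n.+1 -> 'I_n.+1 -> aar K | asimplex s})
  (fun m n f s => exist _ (fun i j => sval s (f i) (f j)) (asimplex_res f (svalP s))) _ _).
- by move=> n [s Hs]; apply: sig_eq.
- by move=> k m n f g [s Hs]; apply: sig_eq.
Defined.

Lemma anerve_eq (K : acat) n (x y : anerve K n) :
  (forall i j : 'I_n.+1, i <= j -> sval x i j = sval y i j) -> x = y.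
Proof.
case: x y => [s Hs] [s' Hs'] /= E; apply: sig_eq => /=.
apply: funext => i; apply: funext => j; case: (leqP i j) => [/E //|/ltnW ji].
by rewrite (proj1 Hs) // (proj1 Hs') // E.
Qed.

Section NerveFill.
Variables (K : acat) (n : nat) (k : 'I_n.+1) (h : smap (horn k) (anerve K)).
Hypothesis k_gt0 : 0 < k.
Hypothesis k_lt : k < n.
Variable d : aar K.

Let inh (p q : 'I_n.+1) := in_horn k (ordedge p q).

(** The value of the horn on the edge from [p] to [q]. The default [d] is met only when [n = 2], on
    the edge opposite [k]. *)
Let hE (p q : 'I_n.+1) : aar K :=
  if pselect (inh p q) is left H
  then sval (h 1 (exist _ (ordedge p q) H)) ord0 ord_max else d.

Lemma hE_val m (g : horn k m) (a b : 'I_m.+1) : a <= b ->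
  inh (sval g a) (sval g b) /\ sval (h m g) a b = hE (sval g a) (sval g b).
Proof.
move=> ab; have H : inh (sval g a) (sval g b).
  rewrite /inh -ordedge_comp; apply: in_horn_comp; exact: (svalP g).
split=> //; rewrite /hE; case: pselect => // H'.
have -> : exist _ (ordedge (sval g a) (sval g b)) H' =
   res (ordedge a b) (g : horn k m) :> horn k 1.
  by apply: sig_eq; rewrite /= ordedge_comp.
rewrite smap_res.
change (sval (h m g) a b = sval (h m g) a (ordedge a b ord_max)).
by rewrite ordedge1.
Qed.

Lemma hE_tri m (g : ordmap m n) (a b c : 'I_m.+1) : in_horn k g ->
  a <= b -> b <= c ->
  atgt (hE (g a) (g b)) = asrc (hE (g b) (g c)) /\
  hE (g a) (g c) = acmp (hE (g a) (g b)) (hE (g b) (g c)).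
Proof.
move=> H ab bc; have ac := leq_trans ab bc.
have [_ /= <-] := hE_val (exist _ g H) ab.
have [_ /= <-] := hE_val (exist _ g H) bc.
have [_ /= <-] := hE_val (exist _ g H) ac.
exact: (proj2 (svalP (h m (exist _ g H)))).
Qed.

Lemma hE_id p : hE p p = aid (asrc (hE p p)).
Proof.
have H : in_horn k (ordmap_const 0 p).
  (* A single vertex avoids 0 or [n], and both differ from [k] because the horn is inner. *)
  case: (eqVneq p ord_max) => [->|pn].
    by exists ord0 => [|j]; rewrite -val_eqE /=; lia.
  case: (eqVneq k ord_max) => [kn|kn]; first by move: k_lt; rewrite kn /= ltnn.
  by exists ord_max => [|j] //; rewrite eq_sym.
have [_ /= <-] := hE_val (exist _ (ordmap_const 0 p) H) (leqnn (ord0 : 'I_1)).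
exact: (proj1 (svalP (h 0 _))).
Qed.

Lemma inh_avoid (p q i : 'I_n.+1) :
  p <= q -> i != k -> p != i -> q != i -> inh p q.
Proof.
move=> pq ik pi qi; exists i => // a.
by rewrite /= /ordedge_fun /omax pq; case: ifP.
Qed.

(** Either [k <= i] and the edge avoids 0, or [i < k] and it avoids [n]; an inner horn contains both
    of the opposite faces. *)
Lemma inh_step (i : nat) : i < n -> inh (inord i) (inord i.+1).
Proof.
move=> lin; have ei : nat_of_ord (inord i : 'I_n.+1) = i by rewrite inordK // ltnW.
have eS : nat_of_ord (inord i.+1 : 'I_n.+1) = i.+1 by rewrite inordK.
case: (leqP k i) => ki.
  by apply: (@inh_avoid _ _ ord0); rewrite -?val_eqE /= ?ei ?eS //; lia.
by apply: (@inh_avoid _ _ ord_max); rewrite -?val_eqE /= ?ei ?eS //; lia.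
Qed.

(** If [k <= p] the triangle avoids 0, if [q <= k] it avoids [n]. Otherwise [j = k] works: the
    vertex [i] missed by the edge differs from [k], so the triangle misses it too. *)
Lemma inh_mid (p q : 'I_n.+1) : inh p q -> p.+1 < q ->
  exists j : 'I_n.+1, [/\ p < j, j < q & exists i : 'I_n.+1,
     [/\ i != k, p != i, j != i & q != i]].
Proof.
move=> [i ik H] pq.
have pi : p != i by have := H ord0.
have qi : q != i by have := H ord_max; rewrite ordedge1 //; lia.
have e : nat_of_ord (inord p.+1 : 'I_n.+1) = p.+1.
  by rewrite inordK //; have := ltn_ord q; lia.
case: (leqP k p) => [kp|pk].
  exists (inord p.+1); rewrite e; split=> //; exists ord0.
  by rewrite -!val_eqE /= e; split; lia.
case: (leqP q k) => [qk|kq].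
  exists (inord p.+1); rewrite e; split=> //; exists ord_max.
  by rewrite -!val_eqE /= e; split; lia.
by exists k; split=> //; exists i; split=> //; rewrite eq_sym.
Qed.

Lemma hE_comp (p j q i : 'I_n.+1) : p <= j -> j <= q ->
  i != k -> p != i -> j != i -> q != i ->
  atgt (hE p j) = asrc (hE j q) /\ hE p q = acmp (hE p j) (hE j q).
Proof.
move=> pj jq ik pi ji qi; have [g [g0 g1 g2 gr]] := ordtri_ex pj jq.
rewrite -g0 -g1 -g2; apply: hE_tri; rewrite ?inordK //.
by exists i => // c; case: (gr c) => ->.
Qed.

Let st (i : nat) := hE (inord i) (inord i.+1).
Let V (i : nat) := asrc (hE (inord i) (inord i)).

(** A functor on the poset [[n]] is determined by its consecutive steps, all of which lie in the
    horn; the filler is made of their composites. *)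
Fixpoint spine (p e : nat) : aar K :=
  if e is e'.+1 then acmp (spine p e') (st (p + e')) else aid (V p).

Lemma st_end i : i < n -> asrc (st i) = V i /\ atgt (st i) = V i.+1.
Proof.
move=> lin.
have [g [g0 g1 gr]] : exists g : ordmap 1 n,
    [/\ g ord0 = inord i, g ord_max = inord i.+1 & in_horn k g].
  exists (ordedge (inord i) (inord i.+1)); rewrite ordedge1 ?inordK //; last by lia.
  split=> //; exact: inh_step.
rewrite /st /V -g0 -g1; split.
  have [e {1}->] := @hE_tri _ _ ord0 ord0 ord_max gr isT isT.
  by rewrite asrc_cmp.
by have [-> _] := @hE_tri _ _ ord0 ord_max ord_max gr isT isT.
Qed.

Lemma spine_end p e : p + e <= n ->
  asrc (spine p e) = V p /\ atgt (spine p e) = V (p + e).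
Proof.
elim: e => [|e IH] /=; first by rewrite addn0 asrc_id atgt_id.
rewrite addnS => le; have [IH1 IH2] := IH (ltnW le); have [s1 s2] := st_end le.
by rewrite asrc_cmp ?IH2 ?s1 // atgt_cmp ?IH2 ?s1.
Qed.

Lemma spine_add p e e' : p + e + e' <= n ->
  spine p (e + e') = acmp (spine p e) (spine (p + e) e').
Proof.
elim: e' => [|e' IH] /=.
  rewrite !addn0 => le; rewrite acmp_idr //; by have [] := spine_end le.
rewrite !addnS => le; have le1 : p + e + e' <= n by lia.
rewrite /= IH // addnA acmpA //.
- by have [_ ->] := @spine_end p e ltac:(lia); have [-> _] := spine_end le1.
- by have [_ ->] := spine_end le1; have [-> _] := st_end le.
Qed.

(** Strong induction on the length: an edge longer than one step is cut at the vertex given by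
    [inh_mid], inside a triangle of the horn whose other two edges are shorter. *)
Lemma hE_spine e (p q : 'I_n.+1) : q = p + e :> nat -> inh p q -> hE p q = spine p e.
Proof.
elim/ltn_ind: e p q => -[|[|e]] IH p q.
- rewrite addn0 => /ord_inj -> _ /=; rewrite hE_id /V.
  by have -> : inord p = p by apply: ord_inj; rewrite inordK.
- rewrite addn1 => qE _ /=; rewrite /V /st addn0 -qE.
  have ep (r : 'I_n.+1) : inord r = r by apply: ord_inj; rewrite inordK.
  have lp : p < n by have := ltn_ord q; lia.
  have := st_end lp; rewrite /st -qE !ep => -[s1 _].
  by rewrite acmp_idl // s1 /V ep.
- move=> qE H; have [|j [pj jq [i [ik pi ji qi]]]] := inh_mid H; first by lia.
  have [_ ->] := hE_comp (ltnW pj) (ltnW jq) ik pi ji qi.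
  rewrite (IH (j - p)) ?(IH (q - j)); try lia.
  + have -> : spine j (q - j) = spine (p + (j - p)) (q - j) by congr spine; lia.
    rewrite -spine_add; first by congr spine; lia.
    by have := ltn_ord q; lia.
  + exact: inh_avoid (ltnW jq) ik ji qi.
  + exact: inh_avoid (ltnW pj) ik pi ji.
Qed.

Definition nerve_filler (p q : 'I_n.+1) : aar K := spine p (q - p).

Lemma nerve_filler_asimplex : asimplex nerve_filler.
Proof.
split=> [p q qp|p q r pq qr].
  rewrite /nerve_filler; have -> : q - p = 0 by lia.
  by rewrite subnn /= asrc_id.
have lr := ltn_ord r; rewrite /nerve_filler; split.
  have [_ ->] := @spine_end p (q - p) ltac:(lia).
  by have [-> _] := @spine_end q (r - q) ltac:(lia); congr V; lia.
have -> : r - p = (q - p) + (r - q) by lia.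
by rewrite spine_add; [congr (acmp _ (spine _ _)); lia|lia].
Qed.

Lemma nerve_horn_fill : exists s : smap (simplex n) (anerve K),
  smap_comp s (horn_incl k) = h.
Proof.
pose s : anerve K n := exist _ _ nerve_filler_asimplex.
have Hs (m l : nat) (f : ordmap m l) (x : simplex n l) :
    res (res f x : ordmap m n) s = res f (res (x : ordmap l n) s).
  by rewrite -res_comp.
exists (@Smap (simplex n) (anerve K) (fun m x => res x s) Hs).
apply: smap_eq => m g; apply: anerve_eq => a b ab.
have le := omap_homo (sval g) ab; have [H ->] := hE_val g ab.
by rewrite (@hE_spine (sval g b - sval g a) _ _ _ H) // subnKC.
Qed.

End NerveFill.

Lemma anerve_quasicat (K : acat) : quasicat (anerve K).
Proof.
move=> n k h /andP[k0 kn].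
(* The value of the horn at the vertex [k] supplies the default arrow [d]. *)
have H : in_horn k (ordmap_const 0 k).
  by exists ord0 => [|j]; rewrite -val_eqE /=; lia.
exact: (nerve_horn_fill h k0 kn (sval (h 0 (exist _ _ H)) ord0 ord0)).
Qed.

(** * Composition in a quasi-category *)

Lemma ordmap_factor m n (c : 'I_n.+2) (f : ordmap m n.+1) :
  (forall a, f a != c) -> exists w : ordmap m n, f = ordmap_comp (coface c) w.
Proof.
move=> H.
have lt (a : 'I_m.+1) : unbump c (f a) < n.+1.
  have := H a; rewrite -val_eqE /unbump /=.
  by have := ltn_ord (f a); have := ltn_ord c; lia.
have wh (a b : 'I_m.+1) : a <= b -> Ordinal (lt a) <= Ordinal (lt b).
  by move=> /(omap_homo f) /=; rewrite /unbump; lia.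
exists (Ordmap wh); apply: ordmap_eq => a; apply: ord_inj => /=.
by have := H a; rewrite -val_eqE /bump /unbump /=; lia.
Qed.

Lemma coface_inj n (c : 'I_n.+2) m (u v : ordmap m n) :
  ordmap_comp (coface c) u = ordmap_comp (coface c) v -> u = v.
Proof.
move=> E; apply: ordmap_eq => a; apply: (@lift_inj _ c).
exact: (congr1 (fun f : ordmap m n.+1 => f a) E).
Qed.

Lemma coface_coface n (i j : nat) : i < j -> j < n.+3 ->
  ordmap_comp (coface (inord j : 'I_n.+3)) (coface (inord i : 'I_n.+2)) =
  ordmap_comp (coface (inord i : 'I_n.+3)) (coface (inord j.-1 : 'I_n.+2)).
Proof.
move=> ij jn; apply: ordmap_eq => a; apply: ord_inj => /=.
rewrite !inordK /bump; lia.
Qed.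

Section HornFaces.
Variables (X : sSet) (n : nat) (k : 'I_n.+3) (x : 'I_n.+3 -> X n.+1).
Hypothesis compat : forall i j : 'I_n.+3, i < j -> i != k -> j != k ->
  res (coface (inord i)) (x j) = res (coface (inord j.-1)) (x i).

(** For [i < j], a simplex lying in both faces factors through their common face of codimension two:
    [u] avoids [j - 1] and [v] avoids [i], with the same remaining map [w1]. Then [compat]
    applies. *)
Lemma faces_agree m (i j : 'I_n.+3) (u v : ordmap m n.+1) :
  i != k -> j != k ->
  ordmap_comp (coface i) u = ordmap_comp (coface j) v ->
  res u (x i) = res v (x j).
Proof.
wlog ij : i j u v / i < j => [H ik jk E|ik jk E].
  case: (ltngtP i j) => [ij|ji|/ord_inj ij]; first exact: H.
    by apply/esym/H.
  by move: E; rewrite ij => /coface_inj ->.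
have Ea (a : 'I_m.+1) : lift i (u a) = lift j (v a) :> nat.
  by have := congr1 (fun f : ordmap m n.+2 => nat_of_ord (f a)) E.
have jn := ltn_ord j.
have [a|w1 u1] := @ordmap_factor _ _ (inord j.-1) u.
  by rewrite -val_eqE /= inordK; have := Ea a; rewrite /= /bump; lia.
have [a|w2 v2] := @ordmap_factor _ _ (inord i) v.
  by rewrite -val_eqE /= inordK; have := Ea a; rewrite /= /bump; lia.
have w12 : w1 = w2.
  have := coface_coface ij jn; rewrite !inord_val => CC.
  apply: (@coface_inj _ (inord j.-1)); apply: (@coface_inj _ i).
  rewrite -u1 E v2.
  exact: (congr1 (fun f : ordmap n n.+2 => ordmap_comp f w2) CC).
by rewrite u1 v2 !res_comp w12 compat.
Qed.

Lemma horn_factor m (g : horn k m) : exists iw : 'I_n.+3 * ordmap m n.+1,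
  iw.1 != k /\ sval g = ordmap_comp (coface iw.1) iw.2.
Proof.
case: g => g [i ik gi] /=; have [w gw] := ordmap_factor gi.
by exists (i, w).
Qed.

Definition horn_fun m (g : horn k m) : X m :=
  let iw := sval (cid (horn_factor g)) in res iw.2 (x iw.1).

Lemma horn_funE m (g : horn k m) i (w : ordmap m n.+1) : i != k ->
  sval g = ordmap_comp (coface i) w -> horn_fun g = res w (x i).
Proof.
rewrite /horn_fun; case: cid => -[i' w'] /= [ik' gw'] ik gw.
by apply: faces_agree => //; rewrite -gw -gw'.
Qed.

Lemma horn_fun_res m l (f : ordmap m l) (g : horn k l) :
  horn_fun (res f g) = res f (horn_fun g).
Proof.
have [[i w] /= [ik gw]] := horn_factor g.
rewrite (horn_funE ik gw) -res_comp; apply: horn_funE => //=.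
by rewrite gw; apply: ordmap_eq.
Qed.

(** Inner horn filling for horns given by their faces. By [faces_agree], the map out of the horn
    does not depend on the face chosen to factor a simplex. *)
Lemma quasicat_fill : quasicat X -> 0 < k < n.+2 ->
  exists y : X n.+2, forall i, i != k -> res (coface i) y = x i.
Proof.
move=> QX /(QX _ _ (Smap horn_fun_res))[s Es].
exists (s _ (ordmap_id _ : simplex _ _)) => i ik.
rewrite -smap_res.
have ch : in_horn k (coface i) by exists i => // a; rewrite eq_sym neq_lift.
have := congr1 (fun F : smap _ X => F _ (exist _ (coface i) ch : horn k _)) Es.
rewrite /= => E; rewrite [LHS](_ : _ = s _ (coface i : simplex _ _)).
  by rewrite E (@horn_funE _ _ i (ordmap_id _)) ?res_id //=; apply: ordmap_eq.
by apply: (congr1 (@smap_fun _ _ s _)); apply: ordmap_eq.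
Qed.

End HornFaces.

Lemma source_res (X : sSet) n (f : ordmap 1 n) (x : X n) :
  source (res f x) = vertex (f ord0) x.
Proof. exact: vertex_res. Qed.

Lemma target_res (X : sSet) n (f : ordmap 1 n) (x : X n) :
  target (res f x) = vertex (f ord_max) x.
Proof. exact: vertex_res. Qed.

Lemma coface1_ends : [/\ coface (inord 2 : 'I_3) ord0 = inord 0 :> 'I_3,
  coface (inord 2 : 'I_3) ord_max = inord 1,
  coface (inord 0 : 'I_3) ord0 = inord 1, coface (inord 0 : 'I_3) ord_max = inord 2
  & coface (inord 1 : 'I_3) ord0 = inord 0 /\ coface (inord 1 : 'I_3) ord_max = inord 2].
Proof. by split; try split; apply: ord_inj; rewrite /= !inordK. Qed.

Lemma is_composite_ends (X : sSet) (f g h : X 1) : is_composite f g h ->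
  [/\ target f = source g, source h = source f & target h = target g].
Proof.
case=> s [<- <- <-]; rewrite !source_res !target_res.
by case: coface1_ends => -> -> -> -> [-> ->].
Qed.

Lemma is_composite_smap (X Y : sSet) (F : smap X Y) (f g h : X 1) :
  is_composite f g h -> is_composite (F 1 f) (F 1 g) (F 1 h).
Proof. by case=> s [<- <- <-]; exists (F 2 s); rewrite !smap_res. Qed.

Lemma degen_smap (X Y : sSet) (F : smap X Y) (x : X 0) :
  F 1 (degen x) = degen (F 0 x).
Proof. exact: smap_res. Qed.

Lemma source_smap (X Y : sSet) (F : smap X Y) (e : X 1) :
  source (F 1 e) = F 0 (source e).
Proof. exact: vertex_smap. Qed.

Lemma target_smap (X Y : sSet) (F : smap X Y) (e : X 1) :
  target (F 1 e) = F 0 (target e).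
Proof. exact: vertex_smap. Qed.

Lemma is_equiv_smap (X Y : sSet) (F : smap X Y) (f : X 1) :
  is_equiv f -> is_equiv (F 1 f).
Proof.
case=> g [fg gf]; exists (F 1 g).
by rewrite source_smap target_smap -!degen_smap; split; apply: is_composite_smap.
Qed.

Lemma vertex0 (X : sSet) (x : X 0) : vertex ord0 x = x.
Proof. by rewrite -[RHS]res_id; congr res; apply: ordmap_eq => i; rewrite !ord1. Qed.

Lemma source_degen (X : sSet) (x : X 0) : source (degen x) = x.
Proof. by rewrite source_res vertex0. Qed.

Lemma target_degen (X : sSet) (x : X 0) : target (degen x) = x.
Proof. by rewrite target_res vertex0. Qed.

(** For [n = 2], the values [t = 2] and [t = 1] give the two codegeneracies onto [[1]]. *)
Definition ordstep n (t : nat) : ordmap n 1.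
Proof.
refine (@Ordmap n 1 (fun a => if a < t then ord0 else ord_max) _).
move=> a b ab; case: (ltnP a t) => //= ta.
by rewrite [b < t]ltnNge (leq_trans ta ab).
Defined.

Lemma degen_source (X : sSet) (f : X 1) :
  degen (source f) = res (ordmap_const 1 ord0) f.
Proof. by rewrite /degen /source /vertex -res_comp; congr res; apply: ordmap_eq. Qed.

Lemma degen_target (X : sSet) (f : X 1) :
  degen (target f) = res (ordmap_const 1 ord_max) f.
Proof. by rewrite /degen /target /vertex -res_comp; congr res; apply: ordmap_eq. Qed.

Lemma ordstep_faces2 : [/\
  ordmap_comp (ordstep 2 2) (coface (inord 2)) = ordmap_const 1 ord0,
  ordmap_comp (ordstep 2 2) (coface (inord 0)) = ordmap_id 1 &
  ordmap_comp (ordstep 2 2) (coface (inord 1)) = ordmap_id 1].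
Proof. by split; apply: ordmap1_eq; apply: ord_inj; rewrite /= !inordK. Qed.

Lemma ordstep_faces1 : [/\
  ordmap_comp (ordstep 2 1) (coface (inord 2)) = ordmap_id 1,
  ordmap_comp (ordstep 2 1) (coface (inord 0)) = ordmap_const 1 ord_max &
  ordmap_comp (ordstep 2 1) (coface (inord 1)) = ordmap_id 1].
Proof. by split; apply: ordmap1_eq; apply: ord_inj; rewrite /= !inordK. Qed.

Lemma is_composite_idl (X : sSet) (f : X 1) : is_composite (degen (source f)) f f.
Proof.
exists (res (ordstep 2 2) f); rewrite -!res_comp.
by case: ordstep_faces2 => -> -> ->; rewrite degen_source res_id.
Qed.

Lemma is_composite_idr (X : sSet) (f : X 1) : is_composite f (degen (target f)) f.
Proof.
exists (res (ordstep 2 1) f); rewrite -!res_comp.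
by case: ordstep_faces1 => -> -> ->; rewrite degen_target res_id.
Qed.

Section HomotopyCategory.
Variable X : sSet.
Hypothesis QX : quasicat X.

Lemma is_composite_ex (f g : X 1) : target f = source g ->
  exists h, is_composite f g h.
Proof.
(* The face opposite 0 is [g] and the face opposite 2 is [f]; the entry at 1 is junk. *)
move=> fg; pose x (i : 'I_3) : X 1 := if i == ord0 then g else f.
have [||y Hy] := @quasicat_fill X 0 (inord 1) x _ QX.
- move=> i j ij i1 j1.
  have [i0 j2] : i = ord0 /\ j = inord 2.
    move: i1 j1; rewrite -!val_eqE /= inordK // => i1 j1.
    by split; apply: ord_inj; have := ltn_ord j; rewrite ?inordK /=; lia.
  have j0 : (inord 2 == ord0 :> 'I_3) = false by rewrite -val_eqE /= inordK.
  rewrite i0 j2 /x eqxx j0.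
  rewrite [LHS](_ : _ = target f); last first.
    by congr res; apply: ordmap_eq => a; apply: ord_inj; rewrite /= inordK // ord1.
  rewrite fg; congr res; apply: ordmap_eq => a; apply: ord_inj.
  by rewrite /= !inordK // ord1.
- by rewrite inordK.
exists (res (coface (inord 1)) y), y; split=> //; rewrite Hy /x -?val_eqE /= ?inordK //.
Qed.

Let d (i : nat) (s : X 2) : X 1 := res (coface (inord i : 'I_3)) s.

(** The simplex [y] is the missing face of the filler. Each of its edges is shared with one of the
    given faces, and the cosimplicial identities say which. *)
Lemma is_composite_fill3 (k : 'I_4) (x : nat -> X 2) : 0 < k < 3 ->
  (forall i j, i < j -> j < 4 -> i != k -> j != k -> d i (x j) = d j.-1 (x i)) ->
  exists y : X 2, forall i : nat, i < 3 ->
    d i y = if i < k then d k.-1 (x i) else d k (x i.+1).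
Proof.
move=> kb H.
have [||y Hy] := @quasicat_fill X 1 k x _ QX.
- by move=> i j ij ik jk; apply: H.
- by [].
exists (res (coface k) y) => i i3.
case: ltnP => ik.
  have -> : x i = x (inord i : 'I_4) by rewrite inordK // (ltn_trans i3).
  rewrite -Hy; last by rewrite -val_eqE /= inordK; lia.
  rewrite /d -!res_comp; congr res.
  by have := @coface_coface 1 i k ik (ltn_ord k); rewrite inord_val.
have -> : x i.+1 = x (inord i.+1 : 'I_4) by rewrite inordK.
rewrite -Hy; last by rewrite -val_eqE /= inordK; lia.
rewrite /d -!res_comp; congr res.
by have := @coface_coface 1 k i.+1 ik i3; rewrite inord_val /= => <-.
Qed.

Lemma is_composite_assl (a b c ab bc x : X 1) :
  is_composite a b ab -> is_composite b c bc -> is_composite a bc x ->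
  is_composite ab c x.
Proof.
move=> [x3 [x32 x30 x31]] [x0 [x02 x00 x01]] [x2 [x22 x20 x21]].
(* In a 3-simplex with consecutive edges [a], [b], [c] the face opposite 1 has edges [ab], [c], [x];
   it is the one to be found, and entry 1 is junk. *)
pose x' i := match i with 0 => x0 | 1 => x0 | 2 => x2 | _ => x3 end.
have [||y Hy] := @is_composite_fill3 (inord 1) x'.
- by rewrite inordK.
- rewrite inordK // /d => -[|[|[|i]]] [|[|[|[|j]]]] //= _ _ _ _.
  + by rewrite x20 x01.
  + by rewrite x30 x02.
  + by rewrite x32 x22.
have := Hy 0 isT; have := Hy 1 isT; have := Hy 2 isT.
by rewrite inordK //= /d x00 x21 x31 => y2 y1 y0; exists y.
Qed.

Lemma is_composite_assr (a b c ab bc x : X 1) :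
  is_composite a b ab -> is_composite b c bc -> is_composite ab c x ->
  is_composite a bc x.
Proof.
move=> [x3 [x32 x30 x31]] [x0 [x02 x00 x01]] [x1 [x12 x10 x11]].
(* Here the face opposite 2, with edges [a], [bc], [x], is to be found; entry 2 is junk. *)
pose x' i := match i with 0 => x0 | 1 => x1 | 2 => x0 | _ => x3 end.
have [||y Hy] := @is_composite_fill3 (inord 2) x'.
- by rewrite inordK.
- rewrite inordK // /d => -[|[|[|i]]] [|[|[|[|j]]]] //= _ _ _ _.
  + by rewrite x10 x00.
  + by rewrite x30 x02.
  + by rewrite x31 x12.
have := Hy 0 isT; have := Hy 1 isT; have := Hy 2 isT.
by rewrite inordK //= /d x01 x11 x32 => y2 y1 y0; exists y.
Qed.

End HomotopyCategory.

(** * Homotopy categories *)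

Record pmap (P : egraph) (K : acat) := PMap {
  pmob : edge_ob P -> aob K;
  pmar :> edge P -> aar K;
  pmap_src : forall f, asrc (pmar f) = pmob (esrc f);
  pmap_tgt : forall f, atgt (pmar f) = pmob (etgt f);
  pmap_id : forall x, pmar (eid x) = aid (pmob x);
  pmap_cmp : forall f g h, ecomp f g h -> pmar h = acmp (pmar f) (pmar g)
}.

Section PresentedLift.
Variables (P : pres) (K : acat) (M : pmap P K).

Let lift (c : aar (presented P)) : aar K := M (qrep c).

Lemma presented_liftE f : lift (pcls f) = M f.
Proof.
by have /(pmap_cmp M) -> := rep_cls f; rewrite pmap_id acmp_idr ?pmap_tgt.
Qed.

Definition presented_lift : afun (presented P) K.
Proof.
refine (@AFun (presented P) K (pmob M) lift _ _ _ _).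
- by move=> c; case: (pcls_surj c) => f <-; rewrite presented_liftE pcls_src pmap_src.
- by move=> c; case: (pcls_surj c) => f <-; rewrite presented_liftE pcls_tgt pmap_tgt.
- by move=> x; rewrite -pmap_id -presented_liftE.
- move=> c c'; case: (pcls_surj c) => f <-; case: (pcls_surj c') => g <-.
  rewrite pcls_src pcls_tgt => /ecomp_ex[h H].
  by rewrite -(pcls_cmp H) !presented_liftE (pmap_cmp M H).
Defined.

End PresentedLift.

Definition sset_egraph (X : sSet) : egraph :=
  @EGraph (X 0) (X 1) (@source X) (@target X) (@degen X) (@is_composite X).

Definition quasicat_pres (X : sSet) (QX : quasicat X) : pres :=
  @Pres (sset_egraph X) (@source_degen X) (@target_degen X)
    (@is_composite_ends X) (@is_composite_ex X QX) (@is_composite_idl X)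
    (@is_composite_idr X) (@is_composite_assl X QX) (@is_composite_assr X QX).

Definition ho (X : sSet) (QX : quasicat X) : acat := presented (quasicat_pres QX).

Section Ho.
Variables (X : sSet) (QX : quasicat X).

Definition hcls (e : X 1) : aar (ho QX) := @pcls (quasicat_pres QX) e.

Lemma hcls_src e : asrc (hcls e) = source e. Proof. exact: pcls_src. Qed.
Lemma hcls_tgt e : atgt (hcls e) = target e. Proof. exact: pcls_tgt. Qed.

Lemma hcls_id (x : X 0) : hcls (degen x) = aid (x : aob (ho QX)).
Proof. by []. Qed.

Lemma hcls_surj (c : aar (ho QX)) : exists e, hcls e = c.
Proof. exact: (@pcls_surj (quasicat_pres QX)). Qed.

Lemma hcls_cmp f g h : is_composite f g h -> hcls h = acmp (hcls f) (hcls g).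
Proof. exact: (@pcls_cmp (quasicat_pres QX)). Qed.

Lemma hcls_cmpP f g h : target f = source g ->
  hcls h = acmp (hcls f) (hcls g) -> is_composite f g h.
Proof. exact: (@pcls_cmpP (quasicat_pres QX)). Qed.

Lemma is_equivP f : is_equiv f <-> exists g, aiso (hcls f) g.
Proof.
split=> [[g [fg gf]]|[c]].
  have [s1 _ t1] := is_composite_ends fg; have [s2 _ _] := is_composite_ends gf.
  exists (hcls g); split; rewrite ?hcls_src ?hcls_tgt -?hcls_id //.
    by rewrite -(hcls_cmp fg).
  by rewrite -(hcls_cmp gf).
case: (hcls_surj c) => g <- [].
rewrite !hcls_src !hcls_tgt => gs gt fg gf; exists g.
by split; apply: hcls_cmpP.
Qed.

End Ho.

Notation edge_map X K := (pmap (sset_egraph X) K).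

Definition ho_map (X : sSet) (QX : quasicat X) : edge_map X (ho QX) :=
  @PMap (sset_egraph X) (ho QX) (fun x => x) (hcls QX) (hcls_src QX)
    (hcls_tgt QX) (hcls_id QX) (hcls_cmp QX).

Definition edge_map_post (X : sSet) (K K' : acat) (F : afun K K')
  (M : edge_map X K) : edge_map X K'.
Proof.
refine (@PMap (sset_egraph X) K' (fun x => afob F (pmob M x)) (fun e => F (M e)) _ _ _ _).
- by move=> e; rewrite asrc_fun pmap_src.
- by move=> e; rewrite atgt_fun pmap_tgt.
- by move=> x; rewrite pmap_id afun_id.
- move=> f g h H; rewrite (pmap_cmp M H) afun_cmp // pmap_src pmap_tgt.
  by have [/= -> _ _] := is_composite_ends H.
Defined.

Definition edge_map_pre (X Y : sSet) (K : acat) (M : edge_map Y K)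
  (F : smap X Y) : edge_map X K.
Proof.
refine (@PMap (sset_egraph X) K (fun x => pmob M (F 0 x : edge_ob (sset_egraph Y)))
  (fun e => M (F 1 e : edge (sset_egraph Y))) _ _ _ _).
- by move=> e; rewrite pmap_src /= source_smap.
- by move=> e; rewrite pmap_tgt /= target_smap.
- by move=> x; rewrite -pmap_id /= degen_smap.
- by move=> f g h H; apply: pmap_cmp; apply: is_composite_smap.
Defined.

Definition ho_fun (X Y : sSet) (QX : quasicat X) (QY : quasicat Y)
  (F : smap X Y) : afun (ho QX) (ho QY) :=
  @presented_lift (quasicat_pres QX) _ (edge_map_pre (ho_map QY) F).

Lemma ho_funE (X Y : sSet) (QX : quasicat X) (QY : quasicat Y) (F : smap X Y) e :
  ho_fun QX QY F (hcls QX e) = hcls QY (F 1 e).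
Proof. exact: (@presented_liftE (quasicat_pres QX)). Qed.

Definition anerve_map (K : acat) : edge_map (anerve K) K.
Proof.
refine (@PMap (sset_egraph (anerve K)) K (fun x => asrc (sval x ord0 ord0))
  (fun e => sval e ord0 ord_max) _ _ _ _).
- by move=> f; apply: (asimplex_src _ _ (svalP f)).
- by move=> f; apply: (asimplex_tgt (svalP f)).
- by move=> x; apply: (proj1 (svalP x)).
- move=> f g h [[s Hs] [<- <- <-]] /=.
  case: coface1_ends => /= -> -> -> -> [-> ->].
  by apply: (proj2 (proj2 Hs _ _ _ _ _)); rewrite !inordK.
Defined.

Lemma anerve_map_inj (K : acat) (e e' : anerve K 1) :
  anerve_map K e = anerve_map K e' -> e = e'.
Proof.
move=> E; apply: anerve_eq => i j ij; have [He Hs] := svalP e.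
have Hs' := svalP e'; rewrite /= in E.
elim/ord2P: i ij; elim/ord2P: j => //= _.
- rewrite (proj1 (svalP e)) // (proj1 (svalP e')) //.
  by rewrite -!(asimplex_src ord0 ord_max (svalP _)) E.
- rewrite (proj1 (svalP e)) // (proj1 (svalP e')) //.
  by rewrite -!(@asimplex_tgt _ _ _ ord0 ord_max (svalP _)) // E.
Qed.

Lemma anerve_map_surj (K : acat) (f : aar K) : exists e, anerve_map K e = f.
Proof.
pose s (i j : 'I_2) : aar K := if i < j then f else
  if i == ord0 then aid (asrc f) else aid (atgt f).
have Hs : asimplex s.
{ split=> [i j|i j k]; elim/ord2P: i; elim/ord2P: j => //=;
    rewrite /s /= ?asrc_id ?atgt_id //.
  all: by elim/ord2P: k => //= _ _; split;
    rewrite ?acmp_idl ?acmp_idr ?asrc_id ?atgt_id. }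
by exists (exist _ s Hs).
Qed.

Lemma anerve_smap_eq (X : sSet) (K : acat) (F G : smap X (anerve K)) :
  (forall e, anerve_map K (F 1 e) = anerve_map K (G 1 e)) -> F = G.
Proof.
move=> H; apply: smap_eq => n x; apply: anerve_eq => i j ij.
have := H (res (ordedge i j) x); rewrite !smap_res.
by rewrite /= -[ordedge_fun i j ord_max]/(ordedge i j ord_max) ordedge1.
Qed.

(** Horn filling gives some composite, and its arrow determines it because an edge of the nerve is
    its arrow. *)
Lemma anerve_is_compositeP (K : acat) (f g h : anerve K 1) :
  atgt (anerve_map K f) = asrc (anerve_map K g) ->
  anerve_map K h = acmp (anerve_map K f) (anerve_map K g) -> is_composite f g h.
Proof.
move=> fg hE; have [|h' H] := @is_composite_ex _ (@anerve_quasicat K) f g.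
  move: fg; rewrite pmap_src pmap_tgt /= => fg; apply: anerve_eq => i j _.
  rewrite !ord1 /= (proj1 (svalP f)) // (proj1 (svalP g)) //.
  by congr aid; exact: fg.
suff -> : h = h' by [].
by apply: anerve_map_inj; rewrite hE (pmap_cmp (anerve_map K) H).
Qed.

Lemma anerve_is_equiv (K : acat) (f : anerve K 1) (g : aar K) :
  aiso (anerve_map K f) g -> is_equiv f.
Proof.
case: (anerve_map_surj g) => g' <- [st ts fg gf]; exists g'.
split; apply: anerve_is_compositeP => //.
  by rewrite fg pmap_src; apply: (pmap_id (anerve_map K)).
by rewrite gf pmap_tgt; apply: (pmap_id (anerve_map K)).
Qed.

Lemma edge_map_asimplex (X : sSet) (K : acat) (M : edge_map X K) n (x : X n) :
  asimplex (fun i j => M (res (ordedge i j) x : edge (sset_egraph X))).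
Proof.
split=> [i j ji|i j k ij jk].
  rewrite !ordedge_const // res_comp; set v := res _ x.
  by rewrite (pmap_id M v) asrc_id.
have [g [g0 g1 g2 _]] := ordtri_ex ij jk; have ik := leq_trans ij jk.
rewrite pmap_src pmap_tgt /= source_res target_res ordedge1 //; split=> //.
apply: pmap_cmp; exists (res g x); rewrite -!res_comp.
by case: coface1_ends => /= c0 c1 c2 c3 [c4 c5];
  split; congr res; apply: ordmap1_eq;
  rewrite ?ordedge1 //= ?c0 ?c1 ?c2 ?c3 ?c4 ?c5 ?g0 ?g1 ?g2.
Qed.

(** With [anerve_smap_eq], this is the adjunction between homotopy categories and nerves: maps into
    a nerve amount to functorial assignments on edges. *)
Definition nerve_smap (X : sSet) (K : acat) (M : edge_map X K) :
  smap X (anerve K).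
Proof.
refine (@Smap X (anerve K) (fun n x => exist _ _ (edge_map_asimplex M x)) _).
move=> m n f x; apply: sig_eq => /=; apply: funext => i; apply: funext => j.
by rewrite -res_comp ordedge_comp.
Defined.

Lemma nerve_smapE (X : sSet) (K : acat) (M : edge_map X K) e :
  anerve_map K (nerve_smap M 1 e) = M e.
Proof.
rewrite /=; apply: (congr1 (pmar M)); rewrite -[RHS](@res_id X); congr res.
exact: ordmap1_eq.
Qed.

(** * Evaluating functors and transformations at a vertex *)

Section FunEval.
Variables X Y : sSet.

Definition fun_val (G : Fun X Y 0) : smap X Y.
Proof.
refine (@Smap X Y (fun n x => G n (x, ordmap_const n ord0)) _).
by move=> m n f x; rewrite -smap_res; congr (G _ (_, _)); apply: ordmap_eq.
Defined.

Lemma fun_vertex_val (G : Fun X Y 0) : fun_vertex (fun_val G) = G.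
Proof.
apply: smap_eq => n [x a]; congr (G n (_, _)).
by apply: ordmap_eq => i; rewrite !ord1.
Qed.

Definition fun_eval (x : X 0) : smap (Fun X Y) Y.
Proof.
refine (@Smap (Fun X Y) Y (fun n H => H n (res (ordmap_const n ord0) x, ordmap_id n)) _).
move=> m n f H; rewrite -smap_res; congr (H _ (_, _)).
  by rewrite /= -res_comp; congr res; apply: ordmap_eq.
Defined.

Lemma component_eval (h : Fun X Y 1) x : component h x = fun_eval x 1 h.
Proof. by []. Qed.

Lemma fun_eval_vertex (x : X 0) (F : smap X Y) : fun_eval x 0 (fun_vertex F) = F 0 x.
Proof. by rewrite /= -[in RHS](vertex0 x). Qed.

Variables (h : Fun X Y 1) (F G : smap X Y).
Hypothesis hFG : is_nat_transf h F G.

Lemma component_src x : source (component h x) = F 0 x.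
Proof.
by rewrite component_eval source_smap; case: hFG => -> _; rewrite fun_eval_vertex.
Qed.

Lemma component_tgt x : target (component h x) = G 0 x.
Proof.
by rewrite component_eval target_smap; case: hFG => _ ->; rewrite fun_eval_vertex.
Qed.

(** The naturality square is the image under [h] of the product of [e] with the interval. Its
    diagonal is [d], and its two triangles are the nondegenerate 2-simplices of a square, given by
    the two pairings of codegeneracies. *)
Lemma component_nat (e : X 1) : exists d,
  is_composite (F 1 e) (component h (target e)) d /\
  is_composite (component h (source e)) (G 1 e) d.
Proof.
have Fe : F 1 e = h 1 (e, ordmap_const 1 ord0).
  have [E _] := hFG.
  have := congr1 (fun U : Fun X Y 0 => U 1 (e, ordmap_const 1 ord0)) E.
  by rewrite /= => <-; congr (h _ (_, _)); apply: ordmap_eq.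
have Ge : G 1 e = h 1 (e, ordmap_const 1 ord_max).
  have [_ E] := hFG.
  have := congr1 (fun U : Fun X Y 0 => U 1 (e, ordmap_const 1 ord0)) E.
  by rewrite /= => <-; congr (h _ (_, _)); apply: ordmap_eq.
exists (h 1 (e, ordmap_id 1)); rewrite Fe Ge /component; split.
  exists (h 2 (res (ordstep 2 1) e, ordstep 2 2)); rewrite -!smap_res /= -!res_comp.
  case: ordstep_faces1 => -> -> ->; case: ordstep_faces2 => -> -> ->.
  by rewrite degen_target res_id.
exists (h 2 (res (ordstep 2 2) e, ordstep 2 1)); rewrite -!smap_res /= -!res_comp.
case: ordstep_faces1 => -> -> ->; case: ordstep_faces2 => -> -> ->.
by rewrite degen_source res_id.
Qed.

End FunEval.

(** * Maps out of a localization *)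

Record natiso (X : sSet) (K : acat) (M N : edge_map X K) (th : X 0 -> aar K) :
    Prop := NatIso {
  natiso_src : forall x, asrc (th x) = pmob M (x : edge_ob (sset_egraph X));
  natiso_tgt : forall x, atgt (th x) = pmob N (x : edge_ob (sset_egraph X));
  natiso_iso : forall x, exists g, aiso (th x) g;
  natiso_nat : forall e : X 1,
    acmp (M (e : edge (sset_egraph X))) (th (target e)) =
    acmp (th (source e)) (N (e : edge (sset_egraph X)))
}.

Lemma aiso_cmp (K : acat) (f g f' g' : aar K) : atgt f = asrc f' ->
  aiso f g -> aiso f' g' -> aiso (acmp f f') (acmp g' g).
Proof.
move=> ff' [s t fg gf] [s' t' fg' gf'].
have gg : atgt g' = asrc g by rewrite t' s.
split; rewrite ?asrc_cmp ?atgt_cmp //.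
- by rewrite acmpA ?asrc_cmp ?atgt_cmp // -(acmpA ff') ?s' // fg' -ff' acmp_idr.
- rewrite acmpA ?asrc_cmp ?atgt_cmp // -(acmpA (f := g')) // gf ff'.
  by rewrite acmp_idr ?t'.
Qed.

Lemma natiso_sym (X : sSet) (K : acat) (M N : edge_map X K) th :
  natiso M N th -> exists th', natiso N M th'.
Proof.
case=> s t /choice[th' H] nat; exists th'.
have s' x : asrc (th' x) = pmob N (x : edge_ob (sset_egraph X)).
  by case: (H x) => -> *.
have t' x : atgt (th' x) = pmob M (x : edge_ob (sset_egraph X)).
  by case: (H x) => _ -> *.
split=> // [x|e]; first by exists (th x); apply: aiso_sym.
have [_ _ f1 _] := H (target e); have [_ _ _ f2] := H (source e).
rewrite -[RHS](@acmp_idr _ _ (asrc (th (target e)))) -?f1; last first.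
  by rewrite atgt_cmp ?pmap_tgt ?s ?t' ?pmap_src.
rewrite acmpA ?s' ?t ?atgt_cmp ?pmap_tgt ?t' ?pmap_src ?s //.
rewrite -(@acmpA _ (th' (source e))) ?t' ?pmap_src ?pmap_tgt ?s //.
rewrite nat acmpA ?t' ?s ?t ?pmap_src // f2 t.
by rewrite acmp_idl // pmap_src.
Qed.

Lemma natiso_trans (X : sSet) (K : acat) (M N L : edge_map X K) th th' :
  natiso M N th -> natiso N L th' -> natiso M L (fun x => acmp (th x) (th' x)).
Proof.
case=> s t i nat [s' t' i' nat']; split=> [x|x|x|e].
- by rewrite asrc_cmp ?t ?s'.
- by rewrite atgt_cmp ?t ?s'.
- case: (i x) => g Hg; case: (i' x) => g' Hg'; exists (acmp g' g).
  by apply: aiso_cmp; rewrite ?t ?s'.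
- rewrite acmpA ?pmap_tgt ?s ?t ?s' // nat -acmpA ?pmap_tgt ?pmap_src ?s' ?t // nat'.
  by rewrite acmpA // ?t ?s' // t' pmap_src.
Qed.

(** Evaluation at a vertex preserves equivalences, and an equivalence in a nerve is an isomorphism
    of [K]. *)
Lemma natiso_fun (X : sSet) (K : acat) (h : Fun X (anerve K) 1)
    (F G : Fun X (anerve K) 0) : is_edge h F G -> is_equiv h ->
  natiso (edge_map_pre (anerve_map K) (fun_val F))
         (edge_map_pre (anerve_map K) (fun_val G))
         (fun x => anerve_map K (component h x)).
Proof.
rewrite -[F in is_edge h F]fun_vertex_val -[G in is_edge h _ G]fun_vertex_val.
set F' := fun_val F; set G' := fun_val G => hFG he.
split=> [x|x|x|e].
- by rewrite pmap_src; apply: (congr1 (pmob (anerve_map K))); apply: component_src hFG _.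
- by rewrite pmap_tgt; apply: (congr1 (pmob (anerve_map K))); apply: component_tgt hFG _.
- have := is_equiv_smap (fun_eval _ x) he; rewrite -component_eval.
  move=> /(@is_equivP _ (@anerve_quasicat K) _).
  case=> g Hg; exists (presented_lift (P := quasicat_pres (@anerve_quasicat K)) (anerve_map K) g).
  have := afun_iso (presented_lift (P := quasicat_pres (@anerve_quasicat K)) (anerve_map K)) Hg.
  by rewrite [X in aiso X]presented_liftE.
- have [d [H1 H2]] := component_nat hFG e.
  by rewrite -(pmap_cmp (anerve_map K) H1) -(pmap_cmp (anerve_map K) H2).
Qed.

(** The inverse edge and both witnessing 2-simplices have no vertices besides the source and target
    of [e], so they already lie in the full subset. *)
Lemma fullsub_is_equiv (X : sSet) (P : X 0 -> Prop) (e : fullsub P 1) :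
  is_equiv (sval e) -> is_equiv e.
Proof.
case: e => e Pe /= [g [[s [s2 s0 s1]] [s' [s2' s0' s1']]]].
have v2 (Y : sSet) (x : Y 2) (Q : Y 0 -> Prop) :
    Q (source (res (coface (inord 2)) x)) -> Q (target (res (coface (inord 2)) x)) ->
    Q (target (res (coface (inord 0)) x)) -> forall i, Q (vertex i x).
  rewrite !source_res !target_res; case: coface1_ends => -> -> _ -> _ q0 q1 q2.
  case=> [[|[|[|i]]] Hi] //.
  - by move: q0; congr (Q (vertex _ _)); apply: ord_inj; rewrite inordK.
  - by move: q1; congr (Q (vertex _ _)); apply: ord_inj; rewrite inordK.
  - by move: q2; congr (Q (vertex _ _)); apply: ord_inj; rewrite inordK.
have Ps : P (source e) by apply: Pe.
have Pt : P (target e) by apply: Pe.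
have [gs gt] : source g = target e /\ target g = source e.
  have [|-> _] := is_composite_ends (f := e) (g := g) (h := degen (source e)).
    by exists s.
  by rewrite target_degen.
have Hs : forall i, P (vertex i s) by apply: v2; rewrite ?s2 ?s0 ?gt.
have Hs' : forall i, P (vertex i s') by apply: v2; rewrite ?s2' ?s0' ?gt ?gs.
have Pg : forall i, P (vertex i g).
  by elim/ord2P; [rewrite -/(source g) gs|rewrite -/(target g) gt].
exists (exist _ g Pg); split.
  by exists (exist _ s Hs); split; apply: sig_eq.
by exists (exist _ s' Hs'); split; apply: sig_eq.
Qed.

Definition fullsub_incl (X : sSet) (P : X 0 -> Prop) : smap (fullsub P) X :=
  @Smap (fullsub P) X (fun n x => sval x) (fun _ _ _ _ => erefl).

Section LocalizationLift.
Variables (X D E : sSet) (W : X 1 -> Prop) (l : smap X D).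
Hypothesis QE : quasicat E.
Hypothesis Hl : is_localization W l.

(** The universal property is applied with [E = D], to the identity of [D]. *)
Lemma localization_inverts (e : X 1) : W e -> is_equiv (l 1 e).
Proof.
move=> We; case: Hl => QD /(_ D QD)[H _].
exact: H (fun_vertex (smap_id D)) e We.
Qed.

Lemma localization_ex (M : Fun X E 0) : inverts W M ->
  exists (G : Fun D E 0) (h : Fun X E 1), is_edge h (precomp l 0 G) M /\ is_equiv h.
Proof.
case: Hl => _ /(_ E QE)[H [Gs [_ [h [hn he]]]]] WM.
have PM i : inverts W (vertex i M) by rewrite (ord1 i) vertex0.
pose v : fullsub (inverts W) 0 := exist _ M PM.
exists (Gs 0 v), (sval (component h v)); split; last first.
  apply: (@is_equiv_smap _ _ (fullsub_incl (@inverts X E W)) (component h v)).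
  exact: (is_equiv_smap (fun_eval _ v) he).
split.
  exact: (congr1 sval (component_src hn v)).
exact: (congr1 sval (component_tgt hn v)).
Qed.

(** The inverse [Gs] of restriction carries [h] to the middle edge, and the unit of the equivalence
    links [G1] and [G2] to its ends. The result stays a zigzag, since composing it would need horn
    filling in [Fun D E]; after passage to natural isomorphisms it composes freely. *)
Lemma localization_uniq (G1 G2 : Fun D E 0) (h : Fun X E 1) :
  is_edge h (precomp l 0 G1) (precomp l 0 G2) -> is_equiv h ->
  exists (A1 A2 : Fun D E 0) (h1 h2 h3 : Fun D E 1),
  [/\ is_edge h1 G1 A1 /\ is_equiv h1, is_edge h2 A1 A2 /\ is_equiv h2
    & is_edge h3 G2 A2 /\ is_equiv h3].
Proof.
case: Hl => _ /(_ E QE)[H [Gs [[k [kn ke]] _]]] [hs ht] he.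
have Ph i : inverts W (vertex i h).
  elim/ord2P: i; first by rewrite -/(source h) hs; apply: H.
  by rewrite -/(target h) ht; apply: H.
pose h' : fullsub (inverts W) 1 := exist _ h Ph.
have he' : is_equiv h' by apply: fullsub_is_equiv.
pose F := corestrict H.
exists (Gs 0 (F 0 G1)), (Gs 0 (F 0 G2)), (component k G1), (Gs 1 h'), (component k G2).
split; split.
- by split; [apply: component_src kn _|apply: component_tgt kn _].
- exact: (is_equiv_smap (fun_eval _ G1) ke).
- split; [rewrite source_smap|rewrite target_smap]; congr (Gs 0 _);
    exact: sig_eq.
- exact: is_equiv_smap.
- by split; [apply: component_src kn _|apply: component_tgt kn _].
- exact: (is_equiv_smap (fun_eval _ G2) ke).
Qed.

End LocalizationLift.

(** * The homotopy category of a localization *)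

(** Packing the endpoints allows morphisms with propositionally equal endpoints to be compared
    without transport. *)
Record arrow (C : category) := Arrow {
  adom : C; acod : C; amor : chom adom acod
}.
Arguments Arrow {C adom acod}.

Lemma arrow_inj (C : category) (x y : C) (f g : chom x y) : Arrow f = Arrow g -> f = g.
Proof.
(* Generalizing [Arrow f] to [u] exposes the equalities of endpoints, which proof irrelevance then
   makes trivial. *)
have H (u : arrow C) : u = Arrow g -> exists (e1 : adom u = x) (e2 : acod u = y),
    eq_rect _ (chom x) (eq_rect _ (fun z => chom z _) (amor u) _ e1) _ e2 = g.
  by move=> ->; exists erefl, erefl.
move=> /H[/= e1 [e2 <-]].
by rewrite (Prop_irrelevance e1 erefl) (Prop_irrelevance e2 erefl).
Qed.

Lemma functor_eq (C D : category) (F G : functor C D) :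
  (forall x y (f : chom x y), Arrow (fmor F f) = Arrow (fmor G f)) -> F = G.
Proof.
case: F G => F F1 F2 F3 [G G1 G2 G3] /= H.
have E : F = G by apply: funext => x; apply: (congr1 (@adom D) (H x x (Defs.cid x))).
subst G; have E : F1 = G1.
  apply: functional_extensionality_dep => x; apply: functional_extensionality_dep => y.
  by apply: funext => f; apply: arrow_inj.
by subst G1; congr Functor; apply: Prop_irrelevance.
Qed.

Lemma ord_arrowE n (C : category) (F : functor (ordcat n) C) (i j i' j' : ordcat n)
    (h : chom i j) (h' : chom i' j') : i = i' -> j = j' ->
  Arrow (fmor F h) = Arrow (fmor F h').
Proof. by move=> e e'; subst i' j'; rewrite (bool_irrelevance h h'). Qed.

Section NerveTriangle.
Variables (C : category) (x y z : C) (f : chom x y) (g : chom y z).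

Definition tri_ob (i : nat) : C := match i with 0 => x | 1 => y | _ => z end.

Definition tri_hom (i j : nat) : i <= j -> chom (tri_ob i) (tri_ob j) :=
  match i, j return i <= j -> chom (tri_ob i) (tri_ob j) with
  | 0, 0 => fun=> Defs.cid x
  | 0, 1 => fun=> f
  | 0, _.+2 => fun=> ccomp g f
  | 1, 1 => fun=> Defs.cid y
  | 1, _.+2 => fun=> g
  | _.+2, _.+2 => fun=> Defs.cid z
  | _.+1, 0 => fun h => False_rect _ (notF h)
  | _.+2, 1 => fun h => False_rect _ (notF h)
  end.

Definition nerve_tri : nerve C 2.
Proof.
refine (@Functor (ordcat 2) C (fun i => tri_ob i) (fun i j h => @tri_hom i j h) _ _).
- by case=> [[|[|i]] Hi].
- by case=> [[|[|i]] Hi] [[|[|j]] Hj] [[|[|k]] Hk] //= h h';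
    rewrite /= ?ccomp_idl ?ccomp_idr.
Defined.

Lemma ordcat1_ind (P : forall i j : 'I_2, (i <= j)%N -> Prop) :
  (forall h, P ord0 ord0 h) -> (forall h, P ord0 ord_max h) ->
  (forall h, P ord_max ord_max h) -> forall i j h, P i j h.
Proof. by move=> H0 H1 H2 i j; elim/ord2P: i; elim/ord2P: j. Qed.

Lemma tri_arrowE (i j : nat) (i' j' : nat) (h : i <= j) (h' : i' <= j') :
  i = i' -> j = j' -> Arrow (tri_hom h) = Arrow (tri_hom h').
Proof. by move=> e e'; subst i' j'; rewrite (bool_irrelevance h h'). Qed.

Lemma nerve_edge_comp :
  is_composite (nerve_edge f) (nerve_edge g) (nerve_edge (ccomp g f)).
Proof.
exists nerve_tri; split; apply: functor_eq; apply: ordcat1_ind => h.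
- by apply: (@tri_arrowE _ _ 0 0 _ isT); rewrite /= !inordK.
- by apply: (@tri_arrowE _ _ 0 1 _ isT); rewrite /= !inordK.
- by apply: (@tri_arrowE _ _ 1 1 _ isT); rewrite /= !inordK.
- by apply: (@tri_arrowE _ _ 1 1 _ isT); rewrite /= !inordK.
- by apply: (@tri_arrowE _ _ 1 2 _ isT); rewrite /= !inordK.
- by apply: (@tri_arrowE _ _ 2 2 _ isT); rewrite /= !inordK.
- by apply: (@tri_arrowE _ _ 0 0 _ isT); rewrite /= !inordK.
- by apply: (@tri_arrowE _ _ 0 2 _ isT); rewrite /= !inordK.
- by apply: (@tri_arrowE _ _ 2 2 _ isT); rewrite /= !inordK.
Qed.

End NerveTriangle.

Lemma nerve_edge_src (C : category) (x y : C) (f : chom x y) :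
  source (nerve_edge f) = nerve_vertex x.
Proof. by apply: functor_eq => i j h. Qed.

Lemma nerve_edge_tgt (C : category) (x y : C) (f : chom x y) :
  target (nerve_edge f) = nerve_vertex y.
Proof. by apply: functor_eq => i j h. Qed.

Lemma nerve_edge_id (C : category) (x : C) :
  nerve_edge (Defs.cid x) = degen (nerve_vertex x).
Proof. by apply: functor_eq; apply: ordcat1_ind. Qed.

Lemma nerve_edge_mor (C : category) (e : nerve C 1) : nerve_edge (edge_mor e) = e.
Proof.
apply: functor_eq; apply: ordcat1_ind => h.
- rewrite (_ : h = Defs.cid (ord0 : ordcat 1)) ?fmor_id //; exact: bool_irrelevance.
- exact: (@ord_arrowE 1 C e ord0 ord_max ord0 ord_max (leq0n 1) h erefl erefl).
- rewrite (_ : h = Defs.cid (ord_max : ordcat 1)) ?fmor_id //; exact: bool_irrelevance.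
Qed.

Lemma edge_mor_res (C : category) n (u : ordmap 1 n) (x : nerve C n)
    (i j : ordcat n) (h : chom i j) : u ord0 = i -> u ord_max = j ->
  Arrow (edge_mor (res u x : nerve C 1)) = Arrow (fmor x h).
Proof. exact: ord_arrowE. Qed.

Lemma natiso_eq (X : sSet) (K : acat) (M M' N N' : edge_map X K) th :
  pmar M =1 pmar M' -> pmar N =1 pmar N' -> natiso M N th -> natiso M' N' th.
Proof.
have ob (L L' : edge_map X K) x : pmar L =1 pmar L' -> pmob L x = pmob L' x.
  move=> H; have := pmap_src L (degen x : edge (sset_egraph X)).
  by rewrite H pmap_src /= source_degen => ->.
move=> HM HN [s t i nat]; split=> // [x|x|e].
- by rewrite s; apply: ob.
- by rewrite t; apply: ob.
- by rewrite -HM -HN.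
Qed.

(** The arrow [N e] is the conjugate of [M e] by isomorphisms that depend only on the endpoints. *)
Lemma natiso_faithful (X : sSet) (K' : acat) (M N : edge_map X K') th (e e' : X 1) :
  natiso M N th -> source e = source e' -> target e = target e' ->
  M (e : edge (sset_egraph X)) = M (e' : edge (sset_egraph X)) ->
  N (e : edge (sset_egraph X)) = N (e' : edge (sset_egraph X)).
Proof.
case=> s t i nat se te Me; have := nat e; rewrite Me te nat se.
have [g [gs gt fg gf]] := i (source e').
move=> /(congr1 (acmp g)); rewrite !acmpA ?gs ?t ?pmap_src /= ?se // gf.
by rewrite !acmp_idl ?pmap_src ?t //= se.
Qed.

(** By [hsim_inv] the quotient by [sim] inverts [w]; by [hsim_cyl] every functor inverting [w]
    identifies [sim]-related morphisms. *)
Record homotopical (C : category) (w : forall x y : C, chom x y -> Prop)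
    (sim : forall x y : C, chom x y -> chom x y -> Prop) : Prop := Homotopical {
  hsim_refl : forall x y (f : chom x y), sim x y f f;
  hsim_sym : forall x y (f g : chom x y), sim x y f g -> sim x y g f;
  hsim_trans : forall x y (f g h : chom x y),
    sim x y f g -> sim x y g h -> sim x y f h;
  hsim_comp : forall x y z (g g' : chom y z) (f f' : chom x y),
    sim y z g g' -> sim x y f f' -> sim x z (ccomp g f) (ccomp g' f');
  hsim_inv : forall x y (f : chom x y), w x y f ->
    exists g, sim x x (ccomp g f) (Defs.cid x) /\ sim y y (ccomp f g) (Defs.cid y);
  hsim_cyl : forall x y (f g : chom x y), sim x y f g ->
    exists (c : C) (i0 i1 : chom x c) (p : chom c x) (k : chom c y),
    [/\ w c x p, ccomp p i0 = Defs.cid x, ccomp p i1 = Defs.cid x,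
        ccomp k i0 = f & ccomp k i1 = g]
}.

Section Localization.
Variables (C : category) (w : forall x y : C, chom x y -> Prop).
Variable sim : forall x y : C, chom x y -> chom x y -> Prop.
Arguments w {x y}.
Arguments sim {x y}.
Hypothesis HC : homotopical (@w) (@sim).

Let sim_refl := hsim_refl HC.
Let sim_sym := hsim_sym HC.
Let sim_trans := hsim_trans HC.
Let sim_comp := hsim_comp HC.

Inductive sim_composite : arrow C -> arrow C -> arrow C -> Prop :=
  SimComposite x y z (f : chom x y) (g : chom y z) h :
    sim h (ccomp g f) -> sim_composite (Arrow f) (Arrow g) (Arrow h).

Lemma sim_composite_invl u v t : sim_composite u v t ->
  exists z (g : chom (acod u) z) h,
  [/\ v = Arrow g, t = Arrow h & sim h (ccomp g (amor u))].
Proof. by case=> x y z f g h H; exists z, g, h. Qed.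

Lemma sim_composite_inv x y z (f : chom x y) (g : chom y z) t :
  sim_composite (Arrow f) (Arrow g) t ->
  exists2 h, t = Arrow h & sim h (ccomp g f).
Proof.
case/sim_composite_invl => z' [g' [h [E -> /= H]]].
have e : z = z' by apply: (congr1 (@acod C) E).
by subst z'; have := arrow_inj E => ->; exists h.
Qed.

Definition sim_egraph : egraph :=
  @EGraph C (arrow C) (@adom C) (@acod C) (fun x => Arrow (Defs.cid x)) sim_composite.

Definition sim_pres : pres.
Proof.
refine (@Pres sim_egraph _ _ _ _ _ _ _ _) => //=.
- by move=> f g h [].
- case=> x y f [y' z g] /= e; subst y'.
  exists (Arrow (ccomp g f)); exact: SimComposite.
- by case=> x y f; apply: SimComposite; rewrite ccomp_idr.
- by case=> x y f; apply: SimComposite; rewrite ccomp_idl.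
- move=> a b c ab bc x /sim_composite_invl[z [g [h [-> -> sh]]]].
  case/sim_composite_invl => /= z' [k [l [-> -> sl]]].
  case: a g h sh k l sl => x0 y0 a g h sh k l sl /=.
  case/sim_composite_inv => m -> sm; apply: SimComposite.
  apply: sim_trans sm _; apply: sim_trans (sim_comp sl (sim_refl a)) _.
  by rewrite -ccompA; apply: sim_comp (sim_refl k) (sim_sym sh).
- move=> a b c ab bc x /sim_composite_invl[z [g [h [-> -> sh]]]].
  case/sim_composite_invl => /= z' [k [l [-> -> sl]]].
  case: a g h sh k l sl => x0 y0 a g h sh k l sl /=.
  case/sim_composite_inv => m -> sm; apply: SimComposite.
  apply: sim_trans sm _; apply: sim_trans (sim_comp (sim_refl k) sh) _.
  by rewrite ccompA; apply: sim_comp (sim_sym sl) (sim_refl a).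
Defined.

Let K : acat := presented sim_pres.
Let kcls (x y : C) (f : chom x y) : aar K := @pcls sim_pres (Arrow f).

Lemma kcls_sim (x y : C) (f g : chom x y) : kcls f = kcls g -> sim f g.
Proof.
move=> /pcls_eqP; rewrite /homotopic /= => H.
case: (sim_composite_inv (H : sim_composite (Arrow f) (Arrow (Defs.cid y)) _)).
by move=> h /arrow_inj ->; rewrite ccomp_idl => /sim_sym.
Qed.

Lemma sim_kcls (x y : C) (f g : chom x y) : sim f g -> kcls f = kcls g.
Proof.
move=> H; apply/pcls_eqP; apply: SimComposite; rewrite ccomp_idl; exact: sim_sym.
Qed.

Lemma kcls_comp (x y z : C) (g : chom y z) (f : chom x y) :
  kcls (ccomp g f) = acmp (kcls f) (kcls g).
Proof. by apply: (pcls_cmp (P := sim_pres)); apply: SimComposite. Qed.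

Lemma kcls_surj (u : aar K) (x y : C) : asrc u = x -> atgt u = y ->
  exists f : chom x y, u = kcls f.
Proof.
case: (pcls_surj u) => -[x' y' f] <-; rewrite pcls_src pcls_tgt /= => e e'.
by subst x' y'; exists f.
Qed.

Definition sim_edge_map : edge_map (nerve C) K.
Proof.
refine (@PMap (sset_egraph (nerve C)) K (fun v => fob v ord0)
  (fun e => kcls (edge_mor e)) _ _ _ _).
- by move=> e; apply: pcls_src.
- by move=> e; apply: pcls_tgt.
- move=> x; rewrite -[RHS](pcls_id (P := sim_pres)); congr (pcls _).
  transitivity (Arrow (fmor x (Defs.cid (ord0 : ordcat 0)))); last by rewrite fmor_id.
  exact: edge_mor_res.
- move=> f g h [s [<- <- <-]].
  apply: (pcls_cmp (P := sim_pres)).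
  have i01 : (inord 0 : ordcat 2) <= (inord 1 : ordcat 2) by rewrite !inordK.
  have i12 : (inord 1 : ordcat 2) <= (inord 2 : ordcat 2) by rewrite !inordK.
  case: coface1_ends => c0 c1 c2 c3 [c4 c5].
  rewrite (edge_mor_res s i01 c0 c1) (edge_mor_res s i12 c2 c3).
  rewrite (edge_mor_res s (leq_trans i01 i12) c4 c5).
  apply: SimComposite; rewrite -fmor_comp; exact: sim_refl.
Defined.

Variables (D : sSet) (l : smap (nerve C) D).
Hypothesis Hl : is_localization (fun e : nerve C 1 => w (edge_mor e)) l.
Variable QD : quasicat D.

Definition loc_mor (x y : C) (f : chom x y) : aar (ho QD) := hcls QD (l 1 (nerve_edge f)).

Lemma loc_mor_src x y (f : chom x y) : asrc (loc_mor f) = l 0 (nerve_vertex x).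
Proof. by rewrite hcls_src source_smap nerve_edge_src. Qed.

Lemma loc_mor_tgt x y (f : chom x y) : atgt (loc_mor f) = l 0 (nerve_vertex y).
Proof. by rewrite hcls_tgt target_smap nerve_edge_tgt. Qed.

Lemma loc_mor_id x : loc_mor (Defs.cid x) = aid (l 0 (nerve_vertex x) : aob (ho QD)).
Proof. by rewrite /loc_mor nerve_edge_id degen_smap. Qed.

Lemma loc_mor_comp x y z (g : chom y z) (f : chom x y) :
  loc_mor (ccomp g f) = acmp (loc_mor f) (loc_mor g).
Proof. by apply: hcls_cmp; apply: is_composite_smap; apply: nerve_edge_comp. Qed.

(** The inverted projection [p] has both [i0] and [i1] as sections, so both become its inverse [q];
    composing with [k] gives [f] and [g]. *)
Lemma loc_mor_sim x y (f g : chom x y) : sim f g -> loc_mor f = loc_mor g.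
Proof.
case/(hsim_cyl HC)=> c [i0 [i1 [p [k [wp p0 p1 <- <-]]]]].
have [|q [qs qt pq qp]] := proj1 (is_equivP QD (l 1 (nerve_edge p))).
  exact: (localization_inverts Hl).
rewrite -/(loc_mor p) in qs qt pq qp.
have H (i : chom x c) : ccomp p i = Defs.cid x -> loc_mor i = q.
  move=> pi; rewrite -[LHS](@acmp_idr _ _ (asrc (loc_mor p))); last first.
    by rewrite loc_mor_tgt loc_mor_src.
  rewrite -pq acmpA ?qs // ?loc_mor_tgt ?loc_mor_src //.
  by rewrite -loc_mor_comp pi loc_mor_id acmp_idl // qs loc_mor_tgt.
by rewrite !loc_mor_comp (H i0) ?(H i1).
Qed.

Let quo_ho : afun K (ho QD).
Proof.
apply: (@presented_lift sim_pres).
refine (@PMap sim_egraph (ho QD) (fun x => l 0 (nerve_vertex x))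
  (fun u => loc_mor (amor u)) _ _ _ _).
- by move=> u; apply: loc_mor_src.
- by move=> u; apply: loc_mor_tgt.
- by move=> x; apply: loc_mor_id.
- move=> f g h [x y z a b c H]; rewrite -loc_mor_comp; exact: loc_mor_sim.
Defined.

Let quo_hoE x y (f : chom x y) : quo_ho (kcls f) = loc_mor f.
Proof. exact: (@presented_liftE sim_pres). Qed.

(** [P] extends the quotient functor along [l]. For [th], both [quo_ho] after [P] and the functor to
    the homotopy category restrict along [l] to [loc_mor], the first up to [al], so uniqueness with
    values in the nerve of [ho QD] applies. *)
Lemma localization_quotient : exists (P : edge_map D K) th al,
  natiso (edge_map_post quo_ho P) (ho_map QD) th /\
  natiso (edge_map_pre P l) sim_edge_map al.
Proof.
have [|G [h [hG he]]] := localization_ex (@anerve_quasicat K) Hl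
    (M := fun_vertex (nerve_smap sim_edge_map)).
  move=> e we; have [g [gf fg]] := hsim_inv HC we.
  apply: (@anerve_is_equiv _ _ (kcls g)).
  rewrite [anerve_map _ _](nerve_smapE sim_edge_map e) /=.
  split; rewrite ?pcls_src ?pcls_tgt //.
    by rewrite -[LHS]kcls_comp (sim_kcls gf).
  by rewrite -[LHS]kcls_comp (sim_kcls fg).
pose P : edge_map D K := edge_map_pre (anerve_map K) (fun_val G).
pose qs := nerve_smap (edge_map_post quo_ho (anerve_map K)).
pose gam := nerve_smap (ho_map QD).
have E : precomp l 0 (fun_vertex gam) = postcomp qs 0 (fun_vertex (nerve_smap sim_edge_map)).
  suff E : smap_comp gam l = smap_comp qs (nerve_smap sim_edge_map).
    apply: smap_eq => n [x a].
    exact: (congr1 (fun F : smap (nerve C) (anerve (ho QD)) => F n x) E).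
  apply: anerve_smap_eq => e; rewrite [LHS]nerve_smapE [RHS]nerve_smapE.
  rewrite [RHS](_ : _ = quo_ho (sim_edge_map e)); last first.
    by apply: (congr1 quo_ho); apply: nerve_smapE.
  by rewrite -[sim_edge_map e]/(kcls (edge_mor e)) quo_hoE /loc_mor nerve_edge_mor.
have [||A1 [A2 [h1 [h2 [h3 [[e1 i1] [e2 i2] [e3 i3]]]]]]] :=
    @localization_uniq _ _ _ _ l (@anerve_quasicat (ho QD)) Hl
    (postcomp qs 0 G) (fun_vertex gam) (postcomp qs 1 h).
- case: hG => hs ht; split; first by rewrite source_smap hs; apply: smap_eq.
  by rewrite target_smap ht E.
- exact: is_equiv_smap.
have n1 := natiso_fun e1 i1; have n2 := natiso_fun e2 i2.
have [th3 n3] := natiso_sym (natiso_fun e3 i3).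
have [s t i nat] := natiso_trans (natiso_trans n1 n2) n3.
have n := natiso_fun hG he.
exists P; eexists; eexists; split.
  apply: natiso_eq (natiso_trans (natiso_trans n1 n2) n3) => e.
    exact: (nerve_smapE (edge_map_post quo_ho (anerve_map K))).
  exact: nerve_smapE.
apply: natiso_eq n => e //.
exact: nerve_smapE.
Qed.

(** The object [x] is the value of [P] at [d], as [C / sim] has the objects of [C]; the isomorphism
    is [th] at [d]. *)
Lemma localization_ess_surj (d : D 0) : exists (x : C) (u v : aar (ho QD)),
  [/\ asrc u = d, atgt u = l 0 (nerve_vertex x) & aiso u v].
Proof.
have [P [th [al [[s t i _] _]]]] := localization_quotient.
exists (pmob P (d : edge_ob (sset_egraph D))); have [v iv] := i d; exists v, (th d).
by split; [case: iv => -> _ _ _|case: iv => _ -> _ _|apply: aiso_sym]; rewrite ?s ?t.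
Qed.

Lemma localization_faithful x y (f g : chom x y) : loc_mor f = loc_mor g -> sim f g.
Proof.
have [P [th [al [_ n]]]] := localization_quotient.
move=> H; apply: kcls_sim.
have := @natiso_faithful _ _ _ _ _ (nerve_edge f) (nerve_edge g) n.
rewrite !nerve_edge_src !nerve_edge_tgt; apply=> //.
pose Pho : afun (ho QD) K := @presented_lift (quasicat_pres QD) _ P.
have E e : P e = Pho (hcls QD e) by rewrite [RHS](@presented_liftE (quasicat_pres QD)).
by rewrite /= !E; apply: (congr1 Pho).
Qed.

Lemma localization_full x y (u : aar (ho QD)) :
  asrc u = l 0 (nerve_vertex x) -> atgt u = l 0 (nerve_vertex y) ->
  exists f : chom x y, u = loc_mor f.
Proof.
case: (hcls_surj u) => e <-; rewrite hcls_src hcls_tgt => se te.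
have [P [th [al [n1 [s t i nat]]]]] := localization_quotient.
have ax := s (nerve_vertex x); have tx := t (nerve_vertex x).
have ay := s (nerve_vertex y); have ty := t (nerve_vertex y).
have [bx [bxs bxt bx1 bx2]] := i (nerve_vertex x).
have [by_ [bys byt by1 by2]] := i (nerve_vertex y).
have sPe : asrc (P e) = asrc (al (nerve_vertex x)) by rewrite pmap_src ax /= se.
have tPe : atgt (P e) = asrc (al (nerve_vertex y)) by rewrite pmap_tgt ay /= te.
(* Conjugating [P e] by [al] gives a morphism of [C / sim] between [x] and [y], represented by [f].
   Then [P] agrees on [e] and on the image of [f], and [n1] makes [P] faithful. *)
have [||f Hf] := @kcls_surj (acmp (acmp bx (P e)) (al (nerve_vertex y))) x y.
- by rewrite !asrc_cmp ?atgt_cmp ?bxt ?sPe // bxs tx.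
- by rewrite !atgt_cmp ?bxt ?sPe // ty.
exists f; apply: (natiso_faithful n1);
  rewrite ?source_smap ?target_smap ?nerve_edge_src ?nerve_edge_tgt //.
apply: (congr1 quo_ho).
have := nat (nerve_edge f); rewrite nerve_edge_src nerve_edge_tgt.
rewrite -[sim_edge_map _]/(kcls f) -Hf.
have -> : edge_map_pre P l (nerve_edge f) = P (l 1 (nerve_edge f)) by [].
set Pf := P (l 1 (nerve_edge f)); rewrite !acmpA ?atgt_cmp ?asrc_cmp ?bxt ?bxs ?sPe //.
rewrite bx1 acmp_idl ?sPe // => /(congr1 (fun v => acmp v by_)).
have tPf : atgt Pf = asrc (al (nerve_vertex y)).
  by rewrite ay pmap_tgt /= target_smap nerve_edge_tgt.
by rewrite -!acmpA ?bys ?tPf ?tPe // by1 !acmp_idr ?tPf ?tPe.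
Qed.
End Localization.

(** * Finite biproducts and free modules *)

Section PreadditiveAlgebra.
Import GRing.Theory.
Local Open Scope ring_scope.

Section PreaddTheory.
Variable A : preadd.

Lemma pacomp0l (a b c : A) (f : pahom a b) : pacomp (0 : pahom b c) f = 0.
Proof. by apply: (addrI (pacomp 0 f)); rewrite -pacompDl !addr0. Qed.

Lemma pacomp0r (a b c : A) (g : pahom b c) : pacomp g (0 : pahom a b) = 0.
Proof. by apply: (addrI (pacomp g 0)); rewrite -pacompDr !addr0. Qed.

Lemma pacomp_suml (a b c : A) n (g : 'I_n -> pahom b c) (f : pahom a b) :
  pacomp (\sum_i g i) f = \sum_i pacomp (g i) f.
Proof.
by apply: (big_morph (fun x => pacomp x f)) => [x y|]; [apply: pacompDl|apply: pacomp0l].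
Qed.

Lemma pacomp_sumr (a b c : A) n (g : pahom b c) (f : 'I_n -> pahom a b) :
  pacomp g (\sum_i f i) = \sum_i pacomp g (f i).
Proof.
by apply: (big_morph (fun x => pacomp g x)) => [x y|]; [apply: pacompDr|apply: pacomp0r].
Qed.

(** The biproduct of [n] copies of [a], given by equations so that additive functors and matrix
    computations apply to it directly. *)
Record power (n : nat) (a s : A) := Power {
  pinj : 'I_n -> pahom a s;
  pproj : 'I_n -> pahom s a;
  pprojK : forall k l, pacomp (pproj k) (pinj l) = if k == l then paid a else 0;
  pinj_proj : \sum_k pacomp (pinj k) (pproj k) = paid s
}.

(** Sums in a pre-additive category are biproducts: the projections [p0] and [q] are induced by
    identities and zeros, and the sum of the idempotents is the identity because both restrict to
    [j] and [k]. *)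
Lemma power_exists (a : A) n : additive_cat A -> exists s, inhabited (power n a s).
Proof.
case=> -[z Hz] sums; elim: n => [|n [s [[i p pi ip]]]].
  exists z; constructor; apply: (@Power 0 a z (fun=> 0) (fun=> 0)) => [[]//|].
  rewrite big_ord0; have [[f [_ uf]] _] := Hz z.
  by rewrite -(uf 0) // -(uf (paid z)).
have [s' [j [k Hs]]] := sums a s.
have [p0 [[p0j p0k] _]] := Hs a (paid a) 0.
have [q [[qj qk] _]] := Hs s 0 (paid s).
exists s'; constructor.
apply: (@Power n.+1 a s'
  (fun l => if unlift ord0 l is Some l' then pacomp k (i l') else j)
  (fun l => if unlift ord0 l is Some l' then pacomp (p l') q else p0)) => [l m|].
  case: (unliftP ord0 l) => [l'|] ->; case: (unliftP ord0 m) => [m'|] ->.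
  - rewrite pacompA -(pacompA (p l')) qk pacomp_idr pi.
    by rewrite (inj_eq (@lift_inj _ ord0)).
  - by rewrite -pacompA qj pacomp0r.
  - by rewrite pacompA p0k pacomp0l.
  - by rewrite p0j eqxx.
rewrite big_ord_recl unlift_none.
under eq_bigr => l _ do rewrite liftK pacompA -(pacompA k) pacompA.
have [h [_ uh]] := Hs s' j k.
rewrite -(uh (paid s')); last by rewrite !pacomp_idl.
apply/esym/uh; split.
  rewrite pacompDl -pacompA p0j pacomp_idr pacomp_suml big1 ?addr0 // => l _.
  by rewrite -!pacompA qj !pacomp0r.
rewrite pacompDl -pacompA p0k pacomp0r add0r pacomp_suml.
under eq_bigr => l _ do rewrite -!pacompA qk pacomp_idr.
by rewrite -pacomp_sumr ip pacomp_idr.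
Qed.

Section PowerTheory.
Variables (n : nat) (a s : A) (p : power n a s).

Lemma power_extr (c : A) (x y : pahom s c) :
  (forall k, pacomp x (pinj p k) = pacomp y (pinj p k)) -> x = y.
Proof.
move=> H; rewrite -[x]pacomp_idr -[y]pacomp_idr -(pinj_proj p) !pacomp_sumr.
by apply: eq_bigr => k _; rewrite !pacompA H.
Qed.

Lemma power_extl (c : A) (x y : pahom c s) :
  (forall k, pacomp (pproj p k) x = pacomp (pproj p k) y) -> x = y.
Proof.
move=> H; rewrite -[x]pacomp_idl -[y]pacomp_idl -(pinj_proj p) !pacomp_suml.
by apply: eq_bigr => k _; rewrite -!pacompA H.
Qed.

Lemma power_mid (b c : A) (y : pahom s c) (x : pahom b s) :
  pacomp y x = \sum_k pacomp (pacomp y (pinj p k)) (pacomp (pproj p k) x).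
Proof.
rewrite -{1}[x]pacomp_idl -(pinj_proj p) pacomp_suml pacomp_sumr.
by apply: eq_bigr => k _; rewrite !pacompA.
Qed.

Lemma power_corec (c : A) (x : 'I_n -> pahom c a) :
  exists h : pahom c s, forall k, pacomp (pproj p k) h = x k.
Proof.
exists (\sum_k pacomp (pinj p k) (x k)) => k; rewrite pacomp_sumr (bigD1 k) //=.
rewrite pacompA pprojK eqxx pacomp_idl big1 ?addr0 // => l lk.
by rewrite pacompA pprojK eq_sym (negPf lk) pacomp0l.
Qed.

Lemma power_rec (c : A) (x : 'I_n -> pahom a c) :
  exists h : pahom s c, forall k, pacomp h (pinj p k) = x k.
Proof.
exists (\sum_k pacomp (x k) (pproj p k)) => k; rewrite pacomp_suml (bigD1 k) //=.
rewrite -pacompA pprojK eqxx pacomp_idr big1 ?addr0 // => l lk.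
by rewrite -pacompA pprojK (negPf lk) pacomp0r.
Qed.

End PowerTheory.

Lemma power_matrix n m (a s t : A) (p : power n a s) (q : power m a t)
    (x : 'I_m -> 'I_n -> pahom a a) :
  {h : pahom s t | forall l k, pacomp (pproj q l) (pacomp h (pinj p k)) = x l k}.
Proof.
apply: boolp.cid.
have /choice[y Hy] : forall k, exists y, forall l, pacomp (pproj q l) y = x l k.
  by move=> k; apply: power_corec.
have [h Hh] := power_rec p y; exists h => l k; by rewrite Hh Hy.
Qed.

Lemma power_matrix_eq n m (a s t : A) (p : power n a s) (q : power m a t)
    (x y : pahom s t) :
  (forall l k, pacomp (pproj q l) (pacomp x (pinj p k)) =
               pacomp (pproj q l) (pacomp y (pinj p k))) -> x = y.
Proof.
by move=> H; apply: (power_extr (p := p)) => k; apply: (power_extl (p := q)).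
Qed.

End PreaddTheory.

Lemma pfmor0 (A B : preadd) (F : pfunctor A B) (a b : A) :
  pfmor F (0 : pahom a b) = 0.
Proof. by apply: (addrI (pfmor F 0)); rewrite -pfmorD !addr0. Qed.

Lemma pfmor_sum (A B : preadd) (F : pfunctor A B) (a b : A) n (f : 'I_n -> pahom a b) :
  pfmor F (\sum_i f i) = \sum_i pfmor F (f i).
Proof. exact: (big_morph (@pfmor _ _ F a b) (@pfmorD _ _ F a b) (pfmor0 F a b)). Qed.

(** * Extending a functor from one object to its powers *)

Section Extension.
Variables (M A : preadd) (r : M) (a : A).
Hypothesis Mpow : forall m : M, exists n, inhabited (power n r m).
Hypothesis Aadd : additive_cat A.
Variable phi : pahom r r -> pahom a a.
Hypothesis phiD : forall f g, phi (f + g) = phi f + phi g.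
Hypothesis phi1 : phi (paid r) = paid a.
Hypothesis phiM : forall g f, phi (pacomp g f) = pacomp (phi g) (phi f).

Let phi0 : phi 0 = 0.
Proof. by apply: (addrI (phi 0)); rewrite -phiD !addr0. Qed.

Let phi_sum n (f : 'I_n -> pahom r r) : phi (\sum_i f i) = \sum_i phi (f i).
Proof. exact: (big_morph phi phiD phi0). Qed.

Let nn (m : M) : nat := sval (boolp.cid (Mpow m)).
Let d (m : M) : power (nn m) r m.
Proof. by apply: inhabited_witness; exact: (svalP (boolp.cid (Mpow m))). Qed.
Let X (m : M) : A := sval (boolp.cid (power_exists a (nn m) Aadd)).
Let e (m : M) : power (nn m) a (X m).
Proof. by apply: inhabited_witness; exact: (svalP (boolp.cid (power_exists a (nn m) Aadd))). Qed.

(** The matrix of [u] in the chosen decompositions, with [phi] applied to each entry. *)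
Let G (m m' : M) (u : pahom m m') : pahom (X m) (X m') :=
  sval (power_matrix (e m) (e m') (fun l k =>
    phi (pacomp (pproj (d m') l) (pacomp u (pinj (d m) k))))).

Let GE m m' (u : pahom m m') l k :
  pacomp (pproj (e m') l) (pacomp (G u) (pinj (e m) k)) =
  phi (pacomp (pproj (d m') l) (pacomp u (pinj (d m) k))).
Proof. by rewrite /G; case: power_matrix. Qed.

Let phi_delta n (k l : 'I_n) :
  phi (if k == l then paid r else 0) = if k == l then paid a else 0.
Proof. by case: eqP. Qed.

Let extension : pfunctor M A.
Proof.
refine (@PFunctor M A X G _ _ _).
- move=> m m' u v; apply: (power_matrix_eq (p := e m) (q := e m')) => l k.
  by rewrite pacompDl pacompDr !GE pacompDl pacompDr phiD.
- move=> m; apply: (power_matrix_eq (p := e m) (q := e m)) => l k.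
  by rewrite GE !pacomp_idl !pprojK phi_delta.
- move=> m m' m'' v u; apply: (power_matrix_eq (p := e m) (q := e m'')) => l k.
  rewrite GE -(pacompA v) pacompA (power_mid (d m')) phi_sum.
  rewrite -(pacompA (G v)) [RHS]pacompA (power_mid (e m')); apply: eq_bigr => j _.
  by rewrite phiM -(pacompA _ v) -(pacompA _ (G v)) !GE.
Defined.

(** The decomposition chosen for [r] itself need not be the trivial one, so [F r] is only isomorphic
    to [a]; [t] and its inverse have as entries [phi] of the inclusions and of the projections of
    that decomposition. *)
Lemma power_extension : exists (F : pfunctor M A) (t : pahom (F r) a), is_iso t /\
  forall g : pahom r r, pacomp t (pfmor F g) = pacomp (phi g) t.
Proof.
have [t Ht] := power_rec (e r) (fun k => phi (pinj (d r) k)).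
have [s Hs] := power_corec (e r) (fun k => phi (pproj (d r) k)).
exists extension, t; split.
  exists s; split.
    apply: (power_matrix_eq (p := e r) (q := e r)) => l k.
    by rewrite pacomp_idl -pacompA Ht pacompA Hs -phiM !pprojK phi_delta.
  rewrite (power_mid (e r)) -phi1 -(pinj_proj (d r)) phi_sum.
  by apply: eq_bigr => k _; rewrite Ht Hs phiM.
move=> g; apply: (power_extr (p := e r)) => k.
rewrite -!pacompA Ht -phiM (power_mid (e r) t).
rewrite -(pacomp_idl (pacomp g (pinj (d r) k))) (power_mid (d r) (paid r)) phi_sum.
by apply: eq_bigr => l _; rewrite Ht GE -phiM pacomp_idl.
Qed.

End Extension.

Section Conjugate.
Variables (M A : preadd) (r : M) (F G : pfunctor M A) (u : pahom (F r) (G r)).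
Hypothesis u_nat : forall g : pahom r r, pacomp u (pfmor F g) = pacomp (pfmor G g) u.

(** The only possible component at [m] of a natural transformation with component [u] at [r]. *)
Definition power_conj n (m : M) (d : power n r m) : pahom (F m) (G m) :=
  \sum_k pacomp (pfmor G (pinj d k)) (pacomp u (pfmor F (pproj d k))).

Lemma power_conjE n (m : M) (d : power n r m) (x : pahom r m) :
  pacomp (power_conj d) (pfmor F x) = pacomp (pfmor G x) u.
Proof.
rewrite -[in RHS](pacomp_idl x) -(pinj_proj d) pacomp_suml pfmor_sum !pacomp_suml.
(* The projection of [x] to a summand is an endomorphism of [r], where [u_nat] applies. *)
apply: eq_bigr => k _; rewrite -!pacompA -pfmor_comp u_nat.
by rewrite pacompA -pfmor_comp.
Qed.

Lemma power_conj_nat n n' (m m' : M) (d : power n r m) (d' : power n' r m')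
    (f : pahom m m') :
  pacomp (power_conj d') (pfmor F f) = pacomp (pfmor G f) (power_conj d).
Proof.
rewrite -{1}(pacomp_idr f) -(pinj_proj d) pacomp_sumr pfmor_sum !pacomp_sumr.
apply: eq_bigr => k _; rewrite pacompA pfmor_comp pacompA power_conjE.
by rewrite pfmor_comp -!pacompA.
Qed.

End Conjugate.

Lemma power_conj_inv (M A : preadd) (r : M) (F G : pfunctor M A)
    (u : pahom (F r) (G r)) (v : pahom (G r) (F r)) n (m : M) (d : power n r m) :
  (forall g : pahom r r, pacomp v (pfmor G g) = pacomp (pfmor F g) v) ->
  pacomp v u = paid (F r) -> pacomp (power_conj v d) (power_conj u d) = paid (F m).
Proof.
move=> v_nat vu; rewrite {2}/power_conj pacomp_sumr -pfmor_id -(pinj_proj d) pfmor_sum.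
apply: eq_bigr => k _; rewrite pacompA power_conjE // pfmor_comp.
by rewrite -pacompA (pacompA v) vu pacomp_idl.
Qed.

Lemma power_extension_unique (M A : preadd) (r : M) (F G : pfunctor M A)
    (t : pahom (F r) (G r)) :
  (forall m : M, exists n, inhabited (power n r m)) -> is_iso t ->
  (forall g : pahom r r, pacomp t (pfmor F g) = pacomp (pfmor G g) t) ->
  nat_isomorphic F G.
Proof.
move=> Mpow [s [st ts]] t_nat.
have s_nat (g : pahom r r) : pacomp s (pfmor G g) = pacomp (pfmor F g) s.
  rewrite -[LHS]pacomp_idr -ts -pacompA (pacompA (pfmor G g)) -t_nat.
  by rewrite !pacompA st pacomp_idl.
pose nn (m : M) : nat := sval (boolp.cid (Mpow m)).
have d (m : M) : power (nn m) r m.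
  by apply: inhabited_witness; exact: (svalP (boolp.cid (Mpow m))).
exists (fun m => power_conj t (d m)); split=> [m m' f|m]; first exact: power_conj_nat.
by exists (power_conj s (d m)); split; apply: power_conj_inv.
Qed.

(** * Free modules as powers of the regular module *)

Section FreeModules.
Variable R : pzRingType.

Lemma linhom_sumE (M N : lmodType R^c) n (g : 'I_n -> linhom M N) (x : M) :
  (\sum_k g k : linhom M N) x = \sum_k g k x.
Proof. exact: (big_morph (fun h : linhom M N => h x)). Qed.

Lemma Mod_fgfree_power (M : Mod_fgfree R) :
  exists n, inhabited (power n (regular_module R) M).
Proof.
case: M => M HM; have [n [f [f' fK f'K]]] := HM; exists n; constructor.
pose i (k : 'I_n) (x : (R^c)^o) : M := f ((x : R^c) *: delta_mx 0 k).
pose p (k : 'I_n) (m : M) : (R^c)^o := f' m 0 k.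
have li k : linear (i k).
  by move=> c x y; rewrite /i scalerDl linearD -linearZ /= scalerA.
(* The inverse is given as a bare function; its linearity is tested after applying the injective
   [f]. *)
have lf' : linear f' by move=> c x y; apply: (can_inj fK); rewrite linearP !f'K.
have lp k : linear (p k) by move=> c x y; rewrite /p lf' !mxE.
pose I k := HB.pack_for {linear (R^c)^o -> M} (i k) (GRing.isLinear.Build _ _ _ _ (i k) (li k)).
pose P k := HB.pack_for {linear M -> (R^c)^o} (p k) (GRing.isLinear.Build _ _ _ _ (p k) (lp k)).
pose M' : Mod_fgfree R := exist _ M HM.
apply: (@Power (Mod_fgfree R) n (regular_module R) M'
  (fun k => I k : linhom _ _) (fun k => P k : linhom _ _)) => [k l|].
  apply: linhom_eq => x; rewrite /= /p /i fK !mxE eqxx /=.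
  by case: eqP => _; [apply: (@mulr1 R^c)|apply: (@mulr0 R^c)].
apply: linhom_eq => x; rewrite [LHS]linhom_sumE /= /i /p.
by rewrite -linear_sum -row_sum_delta f'K.
Qed.

Definition regular_val (g : linhom (R^c)^o (R^c)^o) : R := g (1 : R).

(** By right linearity, since [x] is the scalar [x] acting on 1. This identifies the endomorphism
    ring of the right module [R] with [R]. *)
Lemma regular_valK (g : linhom (R^c)^o (R^c)^o) (x : R) : g x = regular_val g * x :> R.
Proof.
have H := linearZ_LR (g : {linear (R^c)^o -> (R^c)^o}) (x : R^c) (1 : R).
by apply: (etrans _ H); congr (g _); apply/esym/(@mulr1 R^c).
Qed.

Lemma Mod_fgfree_extension (A : preadd) (f : pfunctor (one_object R) A) :
  additive_cat A -> exists G : pfunctor (Mod_fgfree R) A,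
    nat_isomorphic (pfunctor_comp G (one_object_to_Mod R)) f.
Proof.
move=> Aadd; pose r := regular_module R.
pose phi (g : pahom r r) := @pfmor _ _ f tt tt (regular_val g).
have [|||G [t [it tn]]] := @power_extension _ _ r (f tt) Mod_fgfree_power Aadd phi.
- by move=> g h; rewrite -pfmorD.
- by rewrite -pfmor_id.
- by move=> g h; rewrite -pfmor_comp; congr (pfmor f _); apply: (regular_valK g (regular_val h)).
exists G, (fun a => match a with tt => t end); split; last by case.
case=> -[] x; rewrite /= tn /phi; congr (pacomp (pfmor f _) t).
exact: (@mulr1 R).
Qed.

(** Every endomorphism of the regular module comes from an element of [R], so naturality over [R] is
    naturality over all of them. *)
Lemma Mod_fgfree_extension_unique (A : preadd) (G G' : pfunctor (Mod_fgfree R) A) :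
  nat_isomorphic (pfunctor_comp G (one_object_to_Mod R))
                 (pfunctor_comp G' (one_object_to_Mod R)) ->
  nat_isomorphic G G'.
Proof.
case=> t [tn ti]; apply: (power_extension_unique Mod_fgfree_power (ti tt)) => g.
have -> : g = pfmor (one_object_to_Mod R) (regular_val g : @pahom (one_object R) tt tt).
  by apply: linhom_eq => x; apply: regular_valK.
exact: (tn tt tt).
Qed.

End FreeModules.

End PreadditiveAlgebra.

(** * Natural isomorphism and cylinders *)

Section NatIsomorphic.
Variables A B : preadd.

Lemma is_iso_comp (a b c : A) (g : pahom b c) (f : pahom a b) :
  is_iso g -> is_iso f -> is_iso (pacomp g f).
Proof.
case=> g' [g'g gg'] [f' [f'f ff']]; exists (pacomp f' g').
rewrite -!pacompA (pacompA g') g'g pacomp_idl f'f; split=> //.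
by rewrite (pacompA f) ff' pacomp_idl gg'.
Qed.

Lemma nat_isomorphic_refl (F : pfunctor A B) : nat_isomorphic F F.
Proof.
exists (fun a => paid (F a)); split=> [a b f|a]; first by rewrite pacomp_idl pacomp_idr.
by exists (paid (F a)); rewrite pacomp_idl.
Qed.

End NatIsomorphic.

Lemma is_iso_pfmor (A B : preadd) (F : pfunctor A B) (a b : A) (f : pahom a b) :
  is_iso f -> is_iso (pfmor F f).
Proof. by case=> g [gf fg]; exists (pfmor F g); rewrite -!pfmor_comp gf fg !pfmor_id. Qed.

Lemma nat_isomorphic_inv (A B : preadd) (F G : pfunctor A B) : nat_isomorphic F G ->
  exists (t : forall a, pahom (F a) (G a)) (s : forall a, pahom (G a) (F a)),
  [/\ forall a b (f : pahom a b), pacomp (t b) (pfmor F f) = pacomp (pfmor G f) (t a),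
      forall a, pacomp (s a) (t a) = paid (F a)
    & forall a, pacomp (t a) (s a) = paid (G a)].
Proof.
case=> t [tn ti]; exists t, (fun a => sval (boolp.cid (ti a))).
by split=> // a; case: (boolp.cid (ti a)) => s [].
Qed.

Lemma nat_isomorphic_sym (A B : preadd) (F G : pfunctor A B) :
  nat_isomorphic F G -> nat_isomorphic G F.
Proof.
case/nat_isomorphic_inv=> t [s [tn st ts]]; exists s.
split=> [a b f|a]; last by exists (t a).
rewrite -[LHS]pacomp_idr -ts -pacompA (pacompA (pfmor G f)) -tn.
by rewrite !pacompA st pacomp_idl.
Qed.

Lemma nat_isomorphic_trans (A B : preadd) (F G H : pfunctor A B) :
  nat_isomorphic F G -> nat_isomorphic G H -> nat_isomorphic F H.
Proof.
case=> t [tn ti] [s [sn si]]; exists (fun a => pacomp (s a) (t a)).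
split=> [a b f|a]; last exact: is_iso_comp.
by rewrite -pacompA tn pacompA sn pacompA.
Qed.

Lemma nat_isomorphic_comp (A B C : preadd) (G G' : pfunctor B C) (F F' : pfunctor A B) :
  nat_isomorphic G G' -> nat_isomorphic F F' ->
  nat_isomorphic (pfunctor_comp G F) (pfunctor_comp G' F').
Proof.
case=> s [sn si] [t [tn ti]].
exists (fun a => pacomp (s (F' a)) (pfmor G (t a))); split=> [a b f|a] /=.
  by rewrite -pacompA -pfmor_comp tn pfmor_comp pacompA sn pacompA.
by apply: is_iso_comp => //; apply: is_iso_pfmor.
Qed.

Section Cylinder.
Variable A : preadd.

(** The product of [A] with the free-living isomorphism. *)
Definition cylinder : preadd :=
  @PreAdd (A * bool)%type (fun x y => pahom x.1 y.1) (fun x => paid x.1)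
    (fun _ _ _ g f => pacomp g f) (fun _ _ f => pacomp_idl f)
    (fun _ _ f => pacomp_idr f) (fun _ _ _ _ h g f => pacompA h g f)
    (fun _ _ _ g g' f => pacompDl g g' f) (fun _ _ _ g f f' => pacompDr g f f').

Definition cylinder_incl (i : bool) : pfunctor A cylinder :=
  @PFunctor A cylinder (fun a => (a, i)) (fun _ _ f => f)
    (fun _ _ _ _ => erefl) (fun _ => erefl) (fun _ _ _ _ _ => erefl).

Definition cylinder_proj : pfunctor cylinder A :=
  @PFunctor cylinder A (fun x => x.1) (fun _ _ f => f)
    (fun _ _ _ _ => erefl) (fun _ => erefl) (fun _ _ _ _ _ => erefl).

Lemma cylinder_proj_incl i : pfunctor_comp cylinder_proj (cylinder_incl i) = pfunctor_id A.
Proof. by congr PFunctor; apply: Prop_irrelevance. Qed.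

Lemma cylinder_proj_weak_equiv : weak_equiv cylinder_proj.
Proof.
exists (cylinder_incl false); split; last first.
  by rewrite cylinder_proj_incl; apply: nat_isomorphic_refl.
exists (fun x : cylinder => paid x.1); split=> [x y f|x] /=.
  by rewrite pacomp_idl pacomp_idr.
by exists (paid x.1); rewrite /= pacomp_idl.
Qed.

Lemma cylinder_additive : additive_cat A -> additive_cat cylinder.
Proof.
case=> -[z Hz] sums; split; first by exists (z, false) => -[a i]; apply: Hz.
move=> [a i] [b j]; have [s [f [g Hs]]] := sums a b.
by exists (s, false), f, g => -[c k]; apply: Hs.
Qed.

Lemma pfunctor_eq (B : preadd) (o : A -> B)
    (m m' : forall a b, pahom a b -> pahom (o a) (o b)) p1 p2 p3 q1 q2 q3 :
  (forall a b (f : pahom a b), m a b f = m' a b f) ->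
  @PFunctor A B o m p1 p2 p3 = @PFunctor A B o m' q1 q2 q3.
Proof.
move=> H; have E : m = m'.
  apply: functional_extensionality_dep => a; apply: functional_extensionality_dep => b.
  by apply: funext => f.
by subst m'; congr PFunctor; apply: Prop_irrelevance.
Qed.

(** All morphisms are transported from [F] by conjugation with [c], which is an identity on the end
    [false] and [t] on the end [true]; there naturality turns the conjugate into the action of
    [G]. *)
Lemma cylinder_homotopy (B : preadd) (F G : pfunctor A B) : nat_isomorphic F G ->
  exists K : pfunctor cylinder B, pfunctor_comp K (cylinder_incl false) = F /\
    pfunctor_comp K (cylinder_incl true) = G.
Proof.
case/nat_isomorphic_inv=> t [s [tn st ts]].
pose o (x : cylinder) : B := if x.2 then G x.1 else F x.1.
pose c (x : cylinder) : pahom (F x.1) (o x) :=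
  match x with (a, i) => if i return pahom (F a) (o (a, i)) then t a else paid (F a) end.
pose d (x : cylinder) : pahom (o x) (F x.1) :=
  match x with (a, i) => if i return pahom (o (a, i)) (F a) then s a else paid (F a) end.
have dc x : pacomp (d x) (c x) = paid (F x.1) by case: x => a [] /=; rewrite ?st ?pacomp_idl.
have cd x : pacomp (c x) (d x) = paid (o x) by case: x => a [] /=; rewrite ?ts ?pacomp_idl.
pose m (x y : cylinder) (f : pahom x y) : pahom (o x) (o y) :=
  pacomp (c y) (pacomp (pfmor F (f : pahom x.1 y.1)) (d x)).
have mD x y (f g : pahom x y) : m x y (f + g)%R = (m x y f + m x y g)%R.
  by rewrite /m pfmorD pacompDl pacompDr.
have m1 x : m x x (paid x) = paid (o x).
  by rewrite /m /= pfmor_id pacomp_idl cd.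
have mM x y z (g : pahom y z) (f : pahom x y) : m x z (pacomp g f) = pacomp (m y z g) (m x y f).
  rewrite /m /= pfmor_comp -!pacompA; congr pacomp; congr pacomp.
  by rewrite (pacompA (d y)) dc pacomp_idl.
exists (@PFunctor cylinder B o m mD m1 mM); split.
  case: F t s tn st ts @o @c @d dc cd @m mD m1 mM => F F1 F2 F3 F4 /= *.
  by apply: pfunctor_eq => a b f; rewrite /= pacomp_idl pacomp_idr.
case: G t s tn st ts @o @c @d dc cd @m mD m1 mM => G G1 G2 G3 G4 /= t s tn st ts *.
by apply: pfunctor_eq => a b f; rewrite /= pacompA tn -pacompA ts pacomp_idr.
Qed.

End Cylinder.

Lemma preAdd_homotopical :
  @homotopical preAdd (@weak_equiv) (@nat_isomorphic).
Proof.
split.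
- exact: nat_isomorphic_refl.
- exact: nat_isomorphic_sym.
- exact: nat_isomorphic_trans.
- exact: nat_isomorphic_comp.
- by [].
- move=> A B F G /cylinder_homotopy[K [K0 K1]].
  exists (cylinder A), (cylinder_incl A false), (cylinder_incl A true), (cylinder_proj A), K.
  by split=> //; [apply: cylinder_proj_weak_equiv|apply: cylinder_proj_incl..].
Qed.

Lemma Add_homotopical :
  @homotopical Add (fun A B => @weak_equiv (sval A) (sval B))
    (fun A B => @nat_isomorphic (sval A) (sval B)).
Proof.
split.
- by move=> *; apply: nat_isomorphic_refl.
- by move=> *; apply: nat_isomorphic_sym.
- by move=> A B F G H; apply: nat_isomorphic_trans.
- by move=> *; apply: nat_isomorphic_comp.
- by [].
- move=> [A HA] B F G /cylinder_homotopy[K [K0 K1]].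
  exists (exist _ (cylinder A) (cylinder_additive HA)).
  exists (cylinder_incl A false), (cylinder_incl A true), (cylinder_proj A), K.
  by split=> //; [apply: cylinder_proj_weak_equiv|apply: cylinder_proj_incl..].
Qed.

(** * Adjunctions and the additive completion *)

Section Adjunction.
Variables (K K' : acat) (L : afun K K') (F : afun K' K).
Variables (eta : aob K -> aar K) (eps : aob K' -> aar K').

Record aadjunction : Prop := AAdjunction {
  eta_src : forall c, asrc (eta c) = c;
  eta_tgt : forall c, atgt (eta c) = afob F (afob L c);
  eps_src : forall d, asrc (eps d) = afob L (afob F d);
  eps_tgt : forall d, atgt (eps d) = d;
  eta_nat : forall f, acmp f (eta (atgt f)) = acmp (eta (asrc f)) (F (L f));
  eps_nat : forall g, acmp (L (F g)) (eps (atgt g)) = acmp (eps (asrc g)) g;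
  adj_triangle_l : forall c, acmp (L (eta c)) (eps (afob L c)) = aid (afob L c);
  adj_triangle_r : forall d, acmp (eta (afob F d)) (F (eps d)) = aid (afob F d)
}.

Hypothesis H : aadjunction.

Lemma transpose_inj c (a b : aar K') : asrc a = afob L c -> asrc b = afob L c ->
  atgt a = atgt b -> acmp (eta c) (F a) = acmp (eta c) (F b) -> a = b.
Proof.
move=> sa sb ab E.
(* An arrow is recovered from its transpose by naturality of [eps] and a triangle identity. *)
have R x : asrc x = afob L c -> x = acmp (L (acmp (eta c) (F x))) (eps (atgt x)).
  move=> sx; rewrite afun_cmp ?(eta_tgt H) ?asrc_fun ?sx //.
  rewrite -acmpA ?(eps_nat H) ?sx; last first.
  - by rewrite (eps_src H) !atgt_fun.
  - by rewrite atgt_fun !asrc_fun (eta_tgt H) sx.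
  rewrite acmpA ?(adj_triangle_l H) ?acmp_idl ?(eps_tgt H) ?sx //.
  by rewrite atgt_fun (eta_tgt H) (eps_src H).
by rewrite (R a) // (R b) // E ab.
Qed.

Lemma transpose_ex c d (f : aar K) : asrc f = c -> atgt f = afob F d ->
  exists g, [/\ asrc g = afob L c, atgt g = d & acmp (eta c) (F g) = f].
Proof.
move=> sf tf.
have e : atgt (L f) = asrc (eps d) by rewrite atgt_fun tf (eps_src H).
exists (acmp (L f) (eps d)); split.
- by rewrite asrc_cmp // asrc_fun sf.
- by rewrite atgt_cmp // (eps_tgt H).
rewrite afun_cmp // acmpA; first last.
- by rewrite atgt_fun asrc_fun e.
- by rewrite (eta_tgt H) !asrc_fun sf.
rewrite -sf -(eta_nat H) -acmpA; first last.
- by rewrite asrc_fun (eta_tgt H) (eps_src H) tf.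
- by rewrite (eta_src H).
by rewrite tf (adj_triangle_r H) acmp_idr.
Qed.

(* [v] is the factorization of the unit through [phi]; both composites of
   [psi] and [v] are identities by uniqueness of factorizations. *)
Lemma universal_arrow_iso c d (phi : aar K) (psi : aar K') :
  asrc phi = c -> atgt phi = afob F d ->
  (forall d' f, asrc f = c -> atgt f = afob F d' ->
     exists v, [/\ asrc v = d, atgt v = d' & acmp phi (F v) = f]) ->
  (forall v, asrc v = d -> atgt v = d -> acmp phi (F v) = phi -> v = aid d) ->
  asrc psi = afob L c -> atgt psi = d -> acmp (eta c) (F psi) = phi ->
  exists v, aiso psi v.
Proof.
move=> sphi tphi ex uniq sp tp E.
have [v [sv tv Ev]] := ex _ _ (eta_src H c) (eta_tgt H c).
exists v; split; rewrite ?sv ?tv ?sp ?tp //.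
- apply: (@transpose_inj c).
  + by rewrite asrc_cmp ?tp ?sv.
  + by rewrite asrc_id.
  + by rewrite atgt_cmp ?atgt_id ?tp ?sv.
  rewrite afun_cmp ?tp ?sv // acmpA ?E ?Ev; first last.
  + by rewrite atgt_fun asrc_fun tp sv.
  + by rewrite (eta_tgt H) asrc_fun sp.
  by rewrite afun_id acmp_idr // (eta_tgt H).
- apply: uniq.
  + by rewrite asrc_cmp ?tv ?sp.
  + by rewrite atgt_cmp ?tv ?sp.
  rewrite afun_cmp ?tv ?sp // acmpA ?Ev ?E //.
  + by rewrite tphi asrc_fun sv.
  + by rewrite atgt_fun asrc_fun tv sp.
Qed.

End Adjunction.

Lemma is_adjunction_ho (C D : sSet) (QC : quasicat C) (QD : quasicat D)
    (L : smap C D) (F : smap D C) (eta : Fun C C 1) (eps : Fun D D 1) :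
  is_adjunction L F eta eps ->
  aadjunction (ho_fun QC QD L) (ho_fun QD QC F)
    (fun c => hcls QC (component eta c)) (fun d => hcls QD (component eps d)).
Proof.
move=> [etaP epsP tri1 tri2]; split.
- by move=> c; rewrite hcls_src (component_src etaP).
- by move=> c; rewrite hcls_tgt (component_tgt etaP).
- by move=> d; rewrite hcls_src (component_src epsP).
- by move=> d; rewrite hcls_tgt (component_tgt epsP).
- move=> f; case: (hcls_surj f) => e <-; rewrite hcls_src hcls_tgt !ho_funE.
  have [d [H1 H2]] := component_nat etaP e.
  by rewrite -(hcls_cmp QC H1) -(hcls_cmp QC H2).
- move=> f; case: (hcls_surj f) => e <-; rewrite hcls_src hcls_tgt !ho_funE.
  have [d [H1 H2]] := component_nat epsP e.
  by rewrite -(hcls_cmp QD H1) -(hcls_cmp QD H2).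
- move=> c; rewrite ho_funE.
  have := is_composite_smap (fun_eval _ c) tri1.
  rewrite degen_smap fun_eval_vertex => /(hcls_cmp QD) E.
  rewrite hcls_id in E; rewrite [RHS]E; congr acmp; congr hcls.
  (* The whiskered counit at [c] is the counit at the image of [c], because [L] preserves degenerate
     edges. *)
  by rewrite /component -degen_smap.
- move=> d; rewrite ho_funE.
  have := is_composite_smap (fun_eval _ d) tri2.
  rewrite degen_smap fun_eval_vertex => /(hcls_cmp QC) E.
  rewrite hcls_id in E; rewrite [RHS]E; congr acmp; congr hcls.
  by rewrite /component -degen_smap.
Qed.

Lemma nerve_map_vertex (C D : category) (F : functor C D) (x : C) :
  nerve_map F 0 (nerve_vertex x) = nerve_vertex (F x).
Proof. by apply: functor_eq => i j h /=; rewrite fmor_id. Qed.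

Lemma nerve_map_edge (C D : category) (F : functor C D) (x y : C) (f : chom x y) :
  nerve_map F 1 (nerve_edge f) = nerve_edge (fmor F f).
Proof. by apply: functor_eq; apply: ordcat1_ind => h /=; rewrite ?fmor_id. Qed.

(** The induced morphism is determined only up to homotopy, so it is asserted both that one exists
    and that each one is an equivalence. The localizations and the adjunction are arbitrary ones
    with the defining properties. *)
Theorem proposition3p2 (R : pzRingType)
    (preAdd_oo Add_oo : sSet)
    (l_preAdd : smap (nerve preAdd) preAdd_oo)
    (l_Add : smap (nerve Add) Add_oo)
    (Hl_preAdd : is_localization weq_preAdd l_preAdd)
    (Hl_Add : is_localization weq_Add l_Add)
    (F : smap Add_oo preAdd_oo)
    (tau : Fun (nerve Add) preAdd_oo 1)
    (Htau : is_nat_equiv tau (smap_comp l_preAdd (nerve_map Add_incl))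
                             (smap_comp F l_Add))
    (L : smap preAdd_oo Add_oo)
    (eta : Fun preAdd_oo preAdd_oo 1) (eps : Fun Add_oo Add_oo 1)
    (Hadj : is_adjunction L F eta eps) :
  let lR := l_preAdd 0 (nerve_vertex (C := preAdd) (one_object R)) in
  let lMod := l_Add 0 (nerve_vertex (C := Add) (ModAdd R)) in
  let induced (psi : Add_oo 1) :=
    exists phi : preAdd_oo 1,
      is_composite
        (l_preAdd 1 (nerve_edge (C := preAdd) (one_object_to_Mod R)))
        (component tau (nerve_vertex (C := Add) (ModAdd R))) phi /\
      is_adjoint_morphism L F eta lR lMod phi psi in
  (exists psi : Add_oo 1, induced psi) /\
  (forall psi : Add_oo 1, induced psi -> is_equiv psi).
Proof.
move=> lR lMod induced.
have Q1 := proj1 Hl_preAdd; have Q2 := proj1 Hl_Add.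
have adj := is_adjunction_ho Q1 Q2 Hadj; have [etaP _ _ _] := Hadj.
have [tauP tauE] := Htau.
pose F' := ho_fun Q2 Q1 F.
pose mor1 (A B : preAdd) (f : chom A B) := loc_mor l_preAdd Q1 f.
pose mor2 (A B : Add) (f : chom A B) := loc_mor l_Add Q2 f.
pose T (A : Add) := hcls Q1 (component tau (nerve_vertex A)).
have T_src (A : Add) : asrc (T A) = l_preAdd 0 (nerve_vertex (sval A : preAdd)).
  rewrite hcls_src (component_src tauP).
  by apply: (congr1 (@smap_fun _ _ l_preAdd 0)); apply: nerve_map_vertex.
have T_tgt (A : Add) : atgt (T A) = F 0 (l_Add 0 (nerve_vertex A)).
  by rewrite hcls_tgt (component_tgt tauP).
have T_iso (A : Add) : exists S, aiso (T A) S.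
  by apply/is_equivP; apply: (is_equiv_smap (fun_eval _ _) tauE).
have T_nat (A B : Add) (f : chom A B) :
    acmp (mor1 (sval A) (sval B) f) (T B) = acmp (T A) (F' (mor2 A B f)).
  have [d [H1 H2]] := component_nat tauP (nerve_edge f).
  rewrite nerve_edge_src nerve_edge_tgt in H1 H2.
  rewrite /F' ho_funE -[RHS](hcls_cmp Q1 H2) (hcls_cmp Q1 H1); congr acmp.
  by congr (hcls Q1 (l_preAdd _ _)); rewrite nerve_map_edge.
pose i : chom (one_object R : preAdd) (Mod_fgfree R) := one_object_to_Mod R.
pose Phi := acmp (mor1 _ _ i) (T (ModAdd R)).
have iT : atgt (mor1 _ _ i) = asrc (T (ModAdd R)) by rewrite loc_mor_tgt T_src.
have Phi_src : asrc Phi = lR by rewrite asrc_cmp // loc_mor_src.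
have Phi_tgt : atgt Phi = F 0 lMod by rewrite atgt_cmp // T_tgt.
(* Naturality of [tau] translates composition with [Phi] in the homotopy category into restriction
   of pre-additive functors along [i]. *)
have Phi_factor (A : Add) (G : chom (ModAdd R) A) :
    acmp Phi (F' (mor2 (ModAdd R) A G)) =
    acmp (mor1 _ _ (pfunctor_comp G i)) (T A).
  rewrite /Phi -acmpA ?T_tgt ?asrc_fun ?loc_mor_src // -T_nat.
  rewrite acmpA ?T_src ?loc_mor_src ?loc_mor_tgt //.
  by congr acmp; apply/esym; apply: (@loc_mor_comp preAdd).
have [phi phiE] : exists phi, is_composite
    (l_preAdd 1 (nerve_edge (C := preAdd) (one_object_to_Mod R)))
    (component tau (nerve_vertex (C := Add) (ModAdd R))) phi.
  by apply: is_composite_ex => //; rewrite -!(hcls_src Q1) -!(hcls_tgt Q1).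
split.
  have [g [sg tg Eg]] := transpose_ex adj Phi_src Phi_tgt.
  case: (hcls_surj g) sg tg Eg => psi <- sg tg Eg.
  rewrite hcls_src in sg; rewrite hcls_tgt in tg.
  exists psi, phi; split=> //; split=> //.
    have [_ s t] := is_composite_ends phiE.
    rewrite /is_edge s t; split.
      by rewrite source_smap nerve_edge_src.
    by rewrite (component_tgt tauP).
  apply: (hcls_cmpP (QX := Q1)).
    by rewrite (component_tgt etaP) source_smap sg.
  by rewrite -ho_funE [RHS]Eg (hcls_cmp Q1 phiE).
move=> psi [phi' [phiE' [[sphi tphi] [spsi tpsi] Epsi]]].
apply/(is_equivP Q2).
have F'iso (u v : aar (ho Q2)) := @afun_iso _ _ F' u v.
apply: (universal_arrow_iso adj Phi_src Phi_tgt).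
- move=> d' f sf tf.
  (* Replacing [d'] by an additive category [A] and removing [T A] turns [f] into the class of a
     functor [f0] from [R] to [A], which extends to [G] on free modules. *)
  have [A [u [u' [su tu iu]]]] := localization_ess_surj Add_homotopical Hl_Add Q2 d'.
  have [S [sS tS TS ST]] := T_iso A.
  have sFu : asrc (F' u) = F 0 d' by rewrite asrc_fun su.
  have tFu : atgt (F' u) = asrc S by rewrite atgt_fun tu sS T_tgt.
  have sf0 : asrc (acmp (acmp f (F' u)) S) = lR.
    by rewrite !asrc_cmp ?atgt_cmp ?tf ?sFu.
  have tf0 : atgt (acmp (acmp f (F' u)) S) = l_preAdd 0 (nerve_vertex (sval A : preAdd)).
    by rewrite !atgt_cmp ?tf ?sFu ?tS.
  have [f0 f0E] := localization_full preAdd_homotopical Hl_preAdd sf0 tf0.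
  have [G HG] := Mod_fgfree_extension f0 (svalP A).
  have [su' tu' uu' u'u] := iu.
  have sG : asrc (mor2 (ModAdd R) A G) = lMod by apply: loc_mor_src.
  have tG : atgt (mor2 (ModAdd R) A G) = asrc u' by rewrite su' tu; apply: loc_mor_tgt.
  exists (acmp (mor2 (ModAdd R) A G) u'); split.
  + by rewrite asrc_cmp.
  + by rewrite atgt_cmp // tu' su.
  have sFu' : asrc (F' u') = atgt (F' u) by rewrite asrc_fun atgt_fun su'.
  have tFG : atgt (F' (mor2 (ModAdd R) A G)) = asrc (F' u').
    by rewrite atgt_fun asrc_fun tG.
  rewrite afun_cmp // acmpA ?Phi_factor //; last by rewrite Phi_tgt asrc_fun sG.
  have -> : mor1 _ _ (pfunctor_comp G i) = acmp (acmp f (F' u)) S.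
    by rewrite f0E; apply: (loc_mor_sim preAdd_homotopical Hl_preAdd).
  rewrite -(acmpA (f := acmp f (F' u))) ?tS ?ST ?T_src //; last first.
    by rewrite atgt_cmp ?tf ?sFu.
  rewrite acmp_idr ?atgt_cmp ?tf ?sFu ?tFu // -acmpA ?tf ?sFu //.
  have [_ _ -> _] := F'iso _ _ iu.
  by rewrite acmp_idr // tf sFu.
- move=> v sv tv E.
  have [G GE] := localization_full Add_homotopical Hl_Add sv tv.
  (* It remains to see that [G] is naturally isomorphic to the identity. This can be tested after
     restriction along [i], where it is the equation [E] with the isomorphism [T] cancelled. *)
  rewrite GE -loc_mor_id; apply: (loc_mor_sim Add_homotopical Hl_Add).
  apply: Mod_fgfree_extension_unique.
  apply: (localization_faithful preAdd_homotopical Hl_preAdd (QD := Q1)).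
  have [S [sS tS TS _]] := T_iso (ModAdd R).
  have cancel (x : chom (one_object R : preAdd) (Mod_fgfree R)) :
      mor1 _ _ x = acmp (acmp (mor1 _ _ x) (T (ModAdd R))) S.
    by rewrite -acmpA ?TS ?acmp_idr ?loc_mor_tgt ?T_src.
  rewrite [LHS]cancel [RHS]cancel; congr acmp.
  rewrite -[LHS](Phi_factor _ G) -[RHS]/(acmp (mor1 _ _ (pfunctor_comp (Defs.cid (ModAdd R)) i)) _).
  by rewrite [pfunctor_comp _ i](@ccomp_idl preAdd) -[RHS]E GE.
- by rewrite hcls_src.
- by rewrite hcls_tgt.
- rewrite -[RHS](hcls_cmp Q1 phiE') ho_funE; apply/esym.
  exact: (hcls_cmp Q1 Epsi).
Qed.
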